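(* Let $d\ge1$ and let $\mathcal{X}$ be the harmonic ensemble with $\pi_L$ points on $\mathbb{S}^d$. If $\phi\in\mathcal{C}^1(\mathbb{S}^d)$ then \[ \operatorname{Var}(\mathcal{X}(\phi))\lesssim L^{d-1}\qquad (L\to\infty). \] Moreover this cannot be improved in general: if $\phi(x)=x_i$, where $x_i$ is any coordinate function, then \[ \operatorname{Var}(\mathcal{X}(\phi))\sim L^{d-1}\qquad (L\to\infty). \]
   Context: $\mathbb{S}^d$ is the unit sphere in $\mathbb{R}^{d+1}$ and $\mu$ its normalized (probability) surface measure. $\Pi_L$ is the space of restrictions to $\mathbb{S}^d$ of polynomials of degree at most $L$ in $d+1$ variables, $\pi_L=\dim\Pi_L=\frac{2L+d}{d}\binom{d+L-1}{L}$, and $K_L(x,y)$ is the reproducing kernel of $\Pi_L$ in $L^2(\mu)$. The harmonic ensemble is the determinantal point process on $\mathbb{S}^d$ with kernel $K_L$ with respect to $\mu$; it has $n=\pi_L$ points a.s., and $(x_1,\dots,x_n)$ drawn from it is the random vector in $(\mathbb{S}^d)^n$ with density $\frac1{n!}\det(K_L(x_i,x_j))_{1\le i,j\le n}$ with respect to $\mu^{\otimes n}$. For a function $\phi:\mathbb{S}^d\to\mathbb{C}$, the linear statistic is $\mathcal{X}(\phi)=\sum_{j=1}^{\pi_L}\phi(x_j)$. For positive sequences, $x_L\lesssim y_L$ means $\limsup_L x_L/y_L\le C$ for some constant $C$ independent of $L$, and $x_L\sim y_L$ means $x_L\lesssim y_L$ and $y_L\lesssim x_L$. *)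

(* Defs.v *)
From HB Require Import structures.
From mathcomp Require Import all_boot all_order all_algebra.
From mathcomp Require Import complex.
(* The notations of mpoly do not parse together with those of analysis. *)
From mathcomp.multinomials Require Import -(notations) mpoly.
From mathcomp Require Import all_classical all_reals all_analysis.

Set Implicit Arguments.
Unset Strict Implicit.
Unset Printing Implicit Defensive.

Import Order.TTheory GRing.Theory Num.Theory.
Import numFieldNormedType.Exports.

Local Open Scope classical_set_scope.
Local Open Scope ring_scope.

(* n-fold product measure, a set function on the library's measurable type of
   n-tuples: a point mass for n = 0, then m (x) m^n transported along
   (x, t) |-> x :: t. *)
Section product_power.
Context {disp : measure_display} {T : measurableType disp} {R : realType}.
Variable m : set T -> \bar R.

Fixpoint product_power (n : nat) : set (n.-tuple T) -> \bar R :=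
  match n with
  | 0%N => \d_([tuple] : 0.-tuple T)
  | k.+1 => pushforward (m \x @product_power k)%E
              (fun xt : T * k.-tuple T => [tuple of xt.1 :: xt.2])
  end.

End product_power.
Arguments product_power {disp T R} m n _.

Definition sphere (R : realType) (d : nat) : Type :=
  {x : 'rV[R]_d.+1 | \sum_i x 0 i ^+ 2 == 1}.

Definition sphere_coord (R : realType) (d : nat) (i : 'I_d.+1) (x : sphere R d) : R :=
  sval x 0 i.

Section sphere_measurable.
Context (R : realType) (d : nat).

Let pole : sphere R d.
Proof.
exists (delta_mx 0 0); rewrite big_ord_recl big1 => [|i _]; rewrite mxE//=.
  by rewrite expr1n addr0.
by rewrite expr0n.
Qed.

HB.instance Definition _ :=
  Choice.copy (sphere R d) {x : 'rV[R]_d.+1 | \sum_i x 0 i ^+ 2 == 1}.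
HB.instance Definition _ := isPointed.Build (sphere R d) pole.

(* The Borel sigma-algebra, as generated by the d + 1 coordinates. *)
Let coords : 'I_d.+1 -> sphere R d -> measurableTypeR R := @sphere_coord R d.

Let sphere_set0 : g_sigma_preimage coords set0.
Proof. exact: sigma_algebra0. Qed.

Let sphere_setC A : g_sigma_preimage coords A -> g_sigma_preimage coords (~` A).
Proof. exact: sigma_algebraC. Qed.

Let sphere_bigcup (F : _^nat) : (forall i, g_sigma_preimage coords (F i)) ->
  g_sigma_preimage coords (\bigcup_i (F i)).
Proof. exact: sigma_algebra_bigcup. Qed.

HB.instance Definition _ :=
  @isMeasurable.Build default_measure_display (sphere R d)
    (g_sigma_preimage coords) sphere_set0 sphere_setC sphere_bigcup.

End sphere_measurable.

Definition lebesgue_power (R : realType) (n : nat) :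
    set (n.-tuple (measurableTypeR R)) -> \bar R :=
  product_power lebesgue_measure n.

(* The part of the closed unit ball, minus the origin, lying above A. *)
Definition cone (R : realType) (d : nat) (A : set (sphere R d)) :
    set (d.+1.-tuple (measurableTypeR R)) :=
  [set t | exists x r, [/\ A x, 0 < r <= 1 &
                           forall i, tnth t i = r * sphere_coord i x]].

(* Polar coordinates: the surface area of A is (d + 1) times the Lebesgue
   measure of the cone over A; normalizing cancels the factor d + 1. *)
Definition surface_measure (R : realType) (d : nat) (A : set (sphere R d)) :
    \bar R :=
  (lebesgue_power (cone A) / lebesgue_power (cone [set: sphere R d]))%E.

(* msize is one more than the degree, and 0 for the zero polynomial. *)
Definition Pi_space (R : realType) (d L : nat) : set (sphere R d -> R) :=
  [set f | exists2 p : mpoly d.+1 R, (msize p <= L.+1)%N &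
     forall x, f x = meval (fun i => sphere_coord i x) p].

(* 0 if there is no finite basis. *)
Definition dimension (R : realType) (T : Type) (V : set (T -> R)) : nat :=
  xget 0%N [set n | exists2 e : 'I_n -> T -> R, (forall i, V (e i)) &
    forall f, V f ->
      exists! c : 'I_n -> R, forall x, f x = \sum_(i < n) c i * e i x].

Definition pi_dim (R : realType) (d L : nat) : nat :=
  dimension (@Pi_space R d L).

Definition reproducing_kernel (R : realType) disp (T : measurableType disp)
    (m : set T -> \bar R) (V : set (T -> R)) (K : T -> T -> R) : Prop :=
  (forall x, V (K x)) /\
  (forall f, V f -> forall x, (f x)%:E = \int[m]_y (f y * K x y)%:E)%E.

(* The reproducing kernel is unique, so that quantifying it existentially
   singles out one law. *)
Definition harmonic_ensemble (R : realType) (d L : nat) disp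
    (Omega : measurableType disp) (P : probability Omega R)
    (X : {mfun Omega >-> (pi_dim R d L).-tuple (sphere R d)}) : Prop :=
  exists2 K, reproducing_kernel (@surface_measure R d) (@Pi_space R d L) K &
    forall A, measurable A ->
      distribution P X A =
      (\int[product_power (@surface_measure R d) (pi_dim R d L)]_(t in A)
        ((pi_dim R d L)`!%:R^-1
         * \det (\matrix_(i, j) K (tnth t i) (tnth t j)))%:E)%E.

Definition linear_statistic (R : realType) (d n : nat) (Omega : Type)
    (phi : sphere R d -> R[i]) (X : Omega -> n.-tuple (sphere R d)) :
    Omega -> R[i] :=
  fun w => \sum_(j < n) phi (tnth (X w) j).

Definition complex_expectation (R : realType) disp
    (Omega : measurableType disp) (P : probability Omega R)
    (Z : Omega -> R[i]) : R[i] :=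
  Complex (fine 'E_P[fun w => complex.Re (Z w)])
          (fine 'E_P[fun w => complex.Im (Z w)]).

(* E |Z - E Z|^2 *)
Definition complex_variance (R : realType) disp
    (Omega : measurableType disp) (P : probability Omega R)
    (Z : Omega -> R[i]) : \bar R :=
  'E_P[fun w => ComplexField.Normc.normc (Z w - complex_expectation P Z) ^+ 2].

(* F is of class C^1 on the open set U of R^n. *)
Definition C1_on (R : realType) (n : nat) (U : set 'rV[R]_n)
    (F : 'rV[R]_n -> R) : Prop :=
  forall x, U x -> differentiable F x /\
    forall v, {for x, continuous (fun y => 'D_v F y)}.

(* C^1 on the sphere as a submanifold: locally the restriction of a C^1
   function of the ambient space. *)
Definition C1_sphere (R : realType) (d : nat) (f : sphere R d -> R) : Prop :=
  forall p : sphere R d, exists (U : set 'rV[R]_d.+1) (F : 'rV[R]_d.+1 -> R),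
    [/\ open U, U (sval p), C1_on U F &
        forall q : sphere R d, U (sval q) -> f q = F (sval q)].

Definition complex_C1_sphere (R : realType) (d : nat)
    (phi : sphere R d -> R[i]) : Prop :=
  C1_sphere (fun x => complex.Re (phi x)) /\
  C1_sphere (fun x => complex.Im (phi x)).

(* In \bar R one has 0^-1 = +oo, so that a vanishing denominator never
   weakens these relations. *)
Definition asymp_le (R : realType) (x y : (\bar R)^nat) : Prop :=
  exists C : R, (limn_esup (fun L => x L / y L) <= C%:E)%E.

Definition asymp_sim (R : realType) (x y : (\bar R)^nat) : Prop :=
  asymp_le x y /\ asymp_le y x.

(* Main.v *)
From HB Require Import structures.
Require Import Defs.
From mathcomp Require Import all_boot all_order all_algebra.
From mathcomp Require Import fingroup perm complex ring lra.
From mathcomp.multinomials Require Import -(notations) mpoly.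
From mathcomp Require Import all_classical all_reals all_analysis measurable_realfun.

(* Write V_L(f) = (1/2) \int\int |f(x) - f(y)|^2 K_L(x,y)^2.  Expanding the
   determinants over a pair of biorthogonal bases shows that Var(X(f)) = V_L(f).
   A C^1 function is Lipschitz for the ambient distance, hence
   V_L(f) <= C \sum_i V_L(x_i), and it remains to compute
   a_L := \sum_i V_L(x_i) = \pi_L - \int\int (x.y) K_L(x,y)^2.
   Put Z = K_{L+1} - K_L.  Since y_i K_L(x,y) has degree at most L + 1 in y,
   \int (x.y) K_L K_{L+1} dy = K_L(x,x); and Z(x,-y) = (-1)^{L+1} Z(x,y), so that
   \int (x.y) Z^2 dy = 0.  Hence a_{L+1} + a_L = \pi_{L+1} - \pi_L, which is solved
   by a_L = 'C(L+d-1, d-1).  The surface measure is invariant under permutations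
   of the coordinates, so that V_L(x_i) = a_L / (d+1) for every i. *)

(** The kernel is never written down: all its properties come from the reproducing property. A
    reproducing kernel is unique, so whatever preserves both mu and Pi_L preserves K_L. Expanding
    K_L over a basis and the dual basis given by the inverse Gram matrix turns inner integrals into
    finite sums, hence into measurable functions. The symmetries used are permutations of the
    coordinates and the antipode. They map boxes to boxes, and this carries the invariance of
    Lebesgue measure over to the surface measure. Since pi_L is defined as the size of some finite
    basis, its value requires an explicit one: the monomials of exponent at most 1 in x_0, which are
    counted by binomial coefficients. With this value the recursion for a_L becomes an instance of
    Pascal's rule. Summing over the coordinates is what makes a_L computable: \sum_i (x_i - y_i)^2 =
    2 - 2 x.y on the sphere, and multiplying by a coordinate raises the degree by at most one. *)

Set Implicit Arguments.
Unset Strict Implicit.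
Unset Printing Implicit Defensive.
Import Order.TTheory GRing.Theory Num.Theory.
Import numFieldNormedType.Exports.
Local Open Scope classical_set_scope.
Local Open Scope ring_scope.

(** * Bounded measurable functions *)

Section bounded_measurable.
Context disp (T : measurableType disp) (R : realType).
Implicit Types f g : T -> R.

(** The functions integrated below are built from polynomials and Lipschitz functions. This class
    contains them, is an algebra, and consists of integrable functions for a finite measure, so one
    predicate settles the side conditions. *)
Definition bounded_measurable f :=
  measurable_fun setT f /\ exists M, forall x, `|f x| <= M.

Lemma bounded_measurable_cst c : bounded_measurable (fun=> c).
Proof. by split => //; exists `|c|. Qed.

Lemma bounded_measurableD f g : bounded_measurable f -> bounded_measurable g ->
  bounded_measurable (fun x => f x + g x).
Proof.
move=> [mf [M fM]] [mg [N gN]]; split; first exact: measurable_funD.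
by exists (M + N) => x; rewrite (le_trans (ler_normD _ _))// lerD.
Qed.

Lemma bounded_measurableM f g : bounded_measurable f -> bounded_measurable g ->
  bounded_measurable (fun x => f x * g x).
Proof.
move=> [mf [M fM]] [mg [N gN]]; split; first exact: measurable_funM.
by exists (M * N) => x; rewrite normrM ler_pM.
Qed.

Lemma bounded_measurableN f : bounded_measurable f ->
  bounded_measurable (fun x => - f x).
Proof.
move=> [mf [M fM]]; split; first exact: measurableT_comp.
by exists M => x; rewrite normrN.
Qed.

Lemma bounded_measurableB f g : bounded_measurable f -> bounded_measurable g ->
  bounded_measurable (fun x => f x - g x).
Proof. by move=> ? ?; apply/bounded_measurableD/bounded_measurableN. Qed.

Lemma bounded_measurableX f n : bounded_measurable f ->
  bounded_measurable (fun x => f x ^+ n).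
Proof.
move=> bf; elim: n => [|n ih]; first exact: bounded_measurable_cst.
by under eq_fun do rewrite exprS; exact: bounded_measurableM.
Qed.

Lemma bounded_measurable_sum I (r : seq I) (P : pred I) (F : I -> T -> R) :
  (forall i, bounded_measurable (F i)) ->
  bounded_measurable (fun x => \sum_(i <- r | P i) F i x).
Proof.
move=> bF; elim: r => [|i r ih].
  rewrite (_ : (fun x => _) = fun=> 0); first exact: bounded_measurable_cst.
  by apply: funext => x; rewrite big_nil.
rewrite (_ : (fun x => _) = fun x => if P i then F i x + \sum_(j <- r | P j) F j x
    else \sum_(j <- r | P j) F j x); last by apply: funext => x; rewrite big_cons.
by case: (P i) => //; exact: bounded_measurableD.
Qed.

Lemma bounded_measurable_prod I (r : seq I) (P : pred I) (F : I -> T -> R) :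
  (forall i, bounded_measurable (F i)) ->
  bounded_measurable (fun x => \prod_(i <- r | P i) F i x).
Proof.
move=> bF; elim: r => [|i r ih].
  rewrite (_ : (fun x => _) = fun=> 1); first exact: bounded_measurable_cst.
  by apply: funext => x; rewrite big_nil.
rewrite (_ : (fun x => _) = fun x => if P i then F i x * \prod_(j <- r | P j) F j x
    else \prod_(j <- r | P j) F j x); last by apply: funext => x; rewrite big_cons.
by case: (P i) => //; exact: bounded_measurableM.
Qed.

Variable mu : {finite_measure set T -> \bar R}.

Lemma bounded_measurable_integrable f : bounded_measurable f ->
  mu.-integrable setT (EFin \o f).
Proof.
move=> [mf [M fM]]; apply: measurable_bounded_integrable => //.
  by rewrite fin_num_fun_lty //; exact: fin_num_measure.
exists M; split; first exact: num_real.
by move=> x Mx y _; apply: le_trans (ltW Mx).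
Qed.


Lemma bmRintegralD f g : bounded_measurable f -> bounded_measurable g ->
  \int[mu]_x (f x + g x) = \int[mu]_x f x + \int[mu]_x g x.
Proof. by move=> bf bg; apply: RintegralD => //; exact: bounded_measurable_integrable. Qed.

Lemma bmRintegralB f g : bounded_measurable f -> bounded_measurable g ->
  \int[mu]_x (f x - g x) = \int[mu]_x f x - \int[mu]_x g x.
Proof. by move=> bf bg; apply: RintegralB => //; exact: bounded_measurable_integrable. Qed.

Lemma bmRintegralZl c f : bounded_measurable f ->
  \int[mu]_x (c * f x) = c * \int[mu]_x f x.
Proof. by move=> bf; apply: RintegralZl => //; exact: bounded_measurable_integrable. Qed.

Lemma bmRintegralZr c f : bounded_measurable f ->
  \int[mu]_x (f x * c) = (\int[mu]_x f x) * c.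
Proof. by move=> bf; apply: RintegralZr => //; exact: bounded_measurable_integrable. Qed.

Lemma bmRintegral_sum I (r : seq I) (P : pred I) (F : I -> T -> R) :
  (forall i, bounded_measurable (F i)) ->
  \int[mu]_x (\sum_(i <- r | P i) F i x) = \sum_(i <- r | P i) \int[mu]_x F i x.
Proof.
move=> bF; elim: r => [|i r ih].
  rewrite big_nil; under eq_Rintegral do rewrite big_nil.
  by rewrite Rintegral_cst// mul0r.
rewrite big_cons; under eq_Rintegral do rewrite big_cons.
case: ifP => // _; rewrite bmRintegralD ?ih//.
exact: bounded_measurable_sum.
Qed.

Lemma le_bmRintegral f g : bounded_measurable f -> bounded_measurable g ->
  (forall x, f x <= g x) -> \int[mu]_x f x <= \int[mu]_x g x.
Proof. by move=> bf bg fg; apply: le_Rintegral => //; exact: bounded_measurable_integrable. Qed.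

Lemma bmRintegralE f : bounded_measurable f ->
  (\int[mu]_x f x)%:E = (\int[mu]_x (f x)%:E)%E.
Proof.
move=> bf; rewrite /Rintegral fineK//.
by apply: integrable_fin_num => //; exact: bounded_measurable_integrable.
Qed.

End bounded_measurable.

Lemma Rintegral_cst_probability disp (T : measurableType disp) (R : realType)
  (P : probability T R) (r : R) : \int[P]_x r = r.
Proof. by rewrite Rintegral_cst// (congr1 fine (probability_setT P)) mulr1. Qed.

(** * Product measures on tuples *)

Section tuple_cons.
Variables (T : Type) (n : nat).

Definition tuple_cons (xt : T * n.-tuple T) : n.+1.-tuple T :=
  [tuple of xt.1 :: xt.2].

Definition tuple_uncons (t : n.+1.-tuple T) : T * n.-tuple T :=
  (thead t, [tuple of behead t]).

Lemma tuple_consK : cancel tuple_cons tuple_uncons.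
Proof.
by move=> [x t]; rewrite /tuple_uncons theadE; congr pair; exact/val_inj.
Qed.

Lemma tuple_unconsK : cancel tuple_uncons tuple_cons.
Proof. by move=> t; rewrite /tuple_cons/= -tuple_eta. Qed.

End tuple_cons.

Section product_power_theory.
Context disp (T : measurableType disp) (R : realType).

Lemma measurable_tuple_cons n : measurable_fun setT (@tuple_cons T n).
Proof. by apply: measurable_cons. Qed.

Lemma measurable_tuple_uncons n : measurable_fun setT (@tuple_uncons T n).
Proof.
by apply/measurable_fun_pair; [exact: measurable_tnth|exact: measurable_behead].
Qed.

(** An alias of [m] carrying the proof [sm], so that instances can attach the sigma-finite structure
    to it. [as_probability] below does the same for total mass one. *)
Definition as_sigma_finite d' (U : measurableType d')
    (m : {measure set U -> \bar R}) (sm : sigma_finite setT m) : set U -> \bar R := m.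

HB.instance Definition _ d' (U : measurableType d')
    (m : {measure set U -> \bar R}) (sm : sigma_finite setT m) :=
  Measure.on (as_sigma_finite sm).

HB.instance Definition _ d' (U : measurableType d')
    (m : {measure set U -> \bar R}) (sm : sigma_finite setT m) :=
  Measure_isSigmaFinite.Build _ _ _ (as_sigma_finite sm) sm.

Definition as_probability d' (U : measurableType d')
    (m : {measure set U -> \bar R}) (m1 : m setT = 1%E) : set U -> \bar R := m.

HB.instance Definition _ d' (U : measurableType d')
    (m : {measure set U -> \bar R}) (m1 : m setT = 1%E) :=
  Measure.on (as_probability m1).

HB.instance Definition _ d' (U : measurableType d')
    (m : {measure set U -> \bar R}) (m1 : m setT = 1%E) :=
  Measure_isProbability.Build _ _ _ (as_probability m1) m1.

(** [product_power] and [surface_measure] are bare set functions; an equation with a bundled measure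
    makes the theory of integration applicable by rewriting. *)
Lemma pushforward_measureP d1 d2 (U : measurableType d1) (V : measurableType d2)
    (m : {measure set U -> \bar R}) (f : U -> V) : measurable_fun setT f ->
  exists M : {measure set V -> \bar R}, pushforward m f = M :> (set V -> \bar R).
Proof.
move=> mf.
pose M : {measure set V -> \bar R} :=
  measure_function_pushforward__canonical__measure_function_Measure m mf.
by exists M.
Qed.

Lemma measurable_tuple_box n (A : 'I_n -> set T) :
  (forall i, measurable (A i)) -> measurable [set t | forall i, A i (tnth t i)].
Proof.
move=> mA; rewrite (_ : [set _ | _] = \bigcap_(i in [set: 'I_n])
    ((@tnth _ T)^~ i @^-1` A i)); last first.
  by apply/seteqP; split => [t At i _|t At i]; exact: At.
apply: fin_bigcap_measurable => // i _.
by rewrite -[X in measurable X]setTI; exact: measurable_tnth.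
Qed.

Lemma product_power_sigma_finite (m : {sigma_finite_measure set T -> \bar R}) n :
  exists2 M : {sigma_finite_measure set (n.-tuple T) -> \bar R},
    product_power m n = M :> (_ -> _) &
    forall A : 'I_n -> set T, (forall i, measurable (A i)) ->
      M [set t | forall i, A i (tnth t i)] = (\prod_(i < n) m (A i))%E.
Proof.
elim: n => [|n [M eM boxM]].
  exists (\d_([tuple] : 0.-tuple T)) => //.
  move=> A mA; rewrite big_ord0 /= diracE mem_set//.
  by move=> -[].
have [N eN] := pushforward_measureP (m \x M)%E (@measurable_tuple_cons n).
have /sigma_finiteP[F [FT ndF Foo]] := sigma_finiteT m.
have /sigma_finiteP[G [GT ndG Goo]] := sigma_finiteT M.
have sN : sigma_finite setT N.
  (* Both exhaustions are nondecreasing, so a point of [F i] paired with a point of [G j] lies in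
     the product of index [maxn i j]. *)
  exists (fun k => @tuple_uncons T n @^-1` (F k `*` G k)).
    rewrite -preimage_bigcup (_ : \bigcup_k _ = setT) ?preimage_setT//.
    rewrite -subTset => -[x t] _.
    have [i _ Fx] : (\bigcup_k F k) x by rewrite -FT.
    have [j _ Gt] : (\bigcup_k G k) t by rewrite -GT.
    exists (maxn i j) => //; split => /=.
      by move: x Fx; exact/subsetPset/ndF/leq_maxl.
    by move: t Gt; exact/subsetPset/ndG/leq_maxr.
  move=> k; have [mF Fk] := Foo k; have [mG Gk] := Goo k; split.
    rewrite -[X in measurable X]setTI; apply: measurable_tuple_uncons => //.
    exact: measurableX.
  rewrite -eN /pushforward -comp_preimage.
  rewrite (_ : _ \o _ = id) ?preimage_id; last by apply/funext => x; exact: tuple_consK.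
  rewrite [ltLHS](product_measure1E m M mF mG) lte_mul_pinfty//.
  by rewrite ge0_fin_numE.
exists (as_sigma_finite sN) => [/=|A mA]; first by rewrite /as_sigma_finite -eN eM.
rewrite /= /as_sigma_finite -eN /pushforward.
rewrite (_ : _ @^-1` _ = A ord0 `*` [set t | forall i, A (lift ord0 i) (tnth t i)]).
  rewrite [LHS]product_measure1E//; last exact: (measurable_tuple_box (fun i => mA (lift ord0 i))).
  by rewrite big_ord_recl/= -boxM.
apply/seteqP; split => [[x t] /= At|[x t] /= [Ax At] i].
  split; first by have := At ord0.
  by move=> i; have := At (lift ord0 i); rewrite tnthS.
have [->//|i0] := eqVneq i ord0.
by case: (unliftP ord0 i) i0 => [j -> _|-> /eqP//]; rewrite tnthS.
Qed.

(** The determinantal density expands into a signed sum of products of one-point functions, so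
    Fubini is wanted for functions of this form, one coordinate at a time. *)
Lemma product_power_probability (m : probability T R) n :
  exists2 M : probability (n.-tuple T) R, product_power m n = M :> (_ -> _) &
    forall h : 'I_n -> T -> R, (forall i, bounded_measurable (h i)) ->
      \int[M]_t (\prod_(i < n) h i (tnth t i)) = \prod_(i < n) \int[m]_x h i x.
Proof.
elim: n => [|n [M eM prodM]].
  exists (\d_([tuple] : 0.-tuple T)) => //.
  move=> h bh; rewrite big_ord0 /Rintegral integral_dirac//=.
    by rewrite indicE mem_set// mul1r big_ord0.
  apply/measurable_EFinP; under eq_fun do rewrite big_ord0.
  exact: measurable_cst.
pose Q : probability _ R := [the probability _ R of (m \x M)%E].
have [N eN] := pushforward_measureP (m \x M)%E (@measurable_tuple_cons n).
have NT : N setT = 1%E.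
  by rewrite -eN /pushforward preimage_setT; exact: (probability_setT (m \x M)%E).
exists (as_probability NT) => [/=|h bh]; first by rewrite /as_probability -eN eM.
have bmt (k : nat) (g : 'I_k -> T -> R) : (forall i, bounded_measurable (g i)) ->
    bounded_measurable (fun t : k.-tuple T => \prod_(i < k) g i (tnth t i)).
  move=> bg; apply: bounded_measurable_prod => i.
  have [mg [C gC]] := bg i; split; last by exists C.
  by apply: measurableT_comp mg _; exact: measurable_tnth.
have /= bh' := bmt _ _ (fun i => bh (lift ord0 i)).
rewrite big_ord_recl/= -prodM// -bmRintegralZr//.
rewrite -[LHS]/(fine _) /= /as_probability -eN integral_pushforward//; last 3 first.
- exact: measurable_tuple_cons.
- by apply/measurable_EFinP; case: (bmt _ _ bh).
- apply: (@bounded_measurable_integrable _ _ _ Q).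
  have [mhh [C hC]] := bmt _ _ bh; split; last by exists C.
  by apply: measurableT_comp mhh _; exact: measurable_tuple_cons.
rewrite preimage_setT -integral12_prod_meas1; last first.
  apply: (@bounded_measurable_integrable _ _ _ Q).
  have [mhh [C hC]] := bmt _ _ bh; split; last by exists C.
  by apply: measurableT_comp mhh _; exact: measurable_tuple_cons.
congr fine; apply: eq_integral => x _.
rewrite -bmRintegralZl// bmRintegralE//; last first.
  exact: (bounded_measurableM (bounded_measurable_cst _ _) bh').
apply: eq_integral => t _; rewrite /= big_ord_recl/=; congr (_ * _)%:E.
by apply: eq_bigr => i _; rewrite tnthS.
Qed.

End product_power_theory.

(** * Variance of a biorthogonal ensemble *)

Section integral_density.
Context disp (U : measurableType disp) (R : realType).

(** [f] and the Radon-Nikodym derivative of [nu] have the same integral over every measurable set,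
    so they agree almost everywhere, and the change of variables holds for the latter. *)
Lemma integral_density (nu mu : probability U R) (f g : U -> R) :
  bounded_measurable f -> bounded_measurable g ->
  (forall A, measurable A -> nu A = \int[mu]_(x in A) (f x)%:E)%E ->
  \int[nu]_x g x = \int[mu]_x (g x * f x).
Proof.
move=> bf bg nuE.
have nu_mu : nu `<< mu.
  apply/null_content_dominatesP => A mA muA; rewrite nuE//.
  apply: null_set_integral => //.
  by apply/measurable_EFinP; apply: measurable_funTS; case: bf.
have ae : ae_eq mu setT (Radon_Nikodym (charge_of_finite_measure nu) mu) (EFin \o f).
  apply: integral_ae_eq => //.
  - exact: Radon_Nikodym_integrable.
  - by apply/measurable_EFinP; case: bf.
  - move=> A _ mA; rewrite -Radon_Nikodym_integral//.
    by rewrite -nuE.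
rewrite /Rintegral -(@Radon_Nikodym_change_of_variables _ _ _ nu mu)//; last first.
  exact: bounded_measurable_integrable.
congr fine; apply: ae_eq_integral => //.
- apply: emeasurable_funM; last by [].
  by apply/measurable_EFinP; case: bg.
- by apply/measurable_EFinP; case: (bounded_measurableM bg bf).
- rewrite (_ : (fun x => (g x * f x)%:E) = (fun x => (EFin \o g) x * (EFin \o f) x)%E) //.
  exact: ae_eqe_mul2l.
Qed.

End integral_density.

Section biorthogonal_ensemble.
Context disp (T : measurableType disp) (R : realType) (mu : probability T R).
Variables (n : nat) (e c : 'I_n -> T -> R).
Hypothesis be : forall k, bounded_measurable (e k).
Hypothesis bc : forall k, bounded_measurable (c k).
Hypothesis ec : forall k l, \int[mu]_x (e k x * c l x) = (k == l)%:R.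
Variable M : probability (n.-tuple T) R.
Hypothesis prodM : forall h : 'I_n -> T -> R,
  (forall i, bounded_measurable (h i)) ->
  \int[M]_t (\prod_(i < n) h i (tnth t i)) = \prod_(i < n) \int[mu]_x h i x.

Let K x y := \sum_k e k x * c k y.
Let detK (t : n.-tuple T) := \det (\matrix_(i, j) K (tnth t i) (tnth t j)).
(** The matrix M(f) of multiplication by [f] compressed to the span of the [e k]; the mean of the
    linear statistic is its trace. *)
Let moment (f : T -> R) k l := \int[mu]_x (f x * e k x * c l x).

Lemma bounded_measurable_tnth (g : T -> R) (i : 'I_n) :
  bounded_measurable g -> bounded_measurable (fun t : n.-tuple T => g (tnth t i)).
Proof.
move=> [mg [C gC]]; split; last by exists C.
by apply: measurableT_comp mg _; exact: measurable_tnth.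
Qed.

(** There are as many points as basis functions, so the kernel matrix is a product of two square
    matrices and its determinant a product of two Leibniz sums. *)
Lemma biorthogonal_detE t : detK t =
  \sum_(s : 'S_n) \sum_(u : 'S_n) (-1) ^+ s * (-1) ^+ u *
    \prod_i (e (s i) (tnth t i) * c (u i) (tnth t i)).
Proof.
rewrite /detK (_ : \matrix_(i, j) _ = (\matrix_(i, k) e k (tnth t i)) *m
    (\matrix_(i, k) c k (tnth t i))^T); last first.
  by apply/matrixP => i j; rewrite !mxE; apply: eq_bigr => k _; rewrite !mxE.
rewrite det_mulmx det_tr /determinant mulr_suml; apply: eq_bigr => s _.
rewrite mulr_sumr; apply: eq_bigr => u _.
rewrite mulrACA -big_split/=; congr (_ * _).
by apply: eq_bigr => i _; rewrite !mxE.
Qed.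

Lemma bounded_measurable_det : bounded_measurable detK.
Proof.
rewrite (funext biorthogonal_detE).
do 2 (apply: bounded_measurable_sum => ?).
apply: bounded_measurableM; first exact: bounded_measurable_cst.
by apply: bounded_measurable_prod => i; apply: bounded_measurableM;
  exact: bounded_measurable_tnth.
Qed.

Lemma integral_prod_det (g : 'I_n -> T -> R) :
  (forall i, bounded_measurable (g i)) ->
  \int[M]_t ((\prod_i g i (tnth t i)) * detK t) =
  \sum_(s : 'S_n) \sum_(r : 'S_n) (-1) ^+ r *
    \prod_i moment (g i) (s i) (s (r i)).
Proof.
move=> bg.
have bh (s u : 'S_n) i : bounded_measurable (fun x => g i x * e (s i) x * c (u i) x).
  by do 2 (apply: bounded_measurableM => //).
have bt (s u : 'S_n) : bounded_measurable (fun t : n.-tuple T =>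
    \prod_i (g i (tnth t i) * e (s i) (tnth t i) * c (u i) (tnth t i))).
  apply: bounded_measurable_prod => i.
  exact: (@bounded_measurable_tnth (fun x => g i x * e (s i) x * c (u i) x)).
have E t : (\prod_i g i (tnth t i)) * detK t =
    \sum_(s : 'S_n) \sum_(u : 'S_n) (-1) ^+ s * (-1) ^+ u *
    \prod_i (g i (tnth t i) * e (s i) (tnth t i) * c (u i) (tnth t i)).
  rewrite biorthogonal_detE mulr_sumr; apply: eq_bigr => s _.
  rewrite mulr_sumr; apply: eq_bigr => u _.
  by rewrite mulrCA -big_split/=; congr (_ * _); apply: eq_bigr => i _; rewrite mulrA.
under eq_Rintegral do rewrite E.
have bst (s u : 'S_n) : bounded_measurable (fun t : n.-tuple T => (-1) ^+ s * (-1) ^+ u *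
    \prod_i (g i (tnth t i) * e (s i) (tnth t i) * c (u i) (tnth t i))).
  by apply: bounded_measurableM => //; exact: bounded_measurable_cst.
rewrite bmRintegral_sum; last by move=> s; exact: bounded_measurable_sum.
apply: eq_bigr => s _; rewrite bmRintegral_sum//.
(* With u = r * s, that is u i = s (r i), the two signs combine into the sign of r. *)
rewrite (reindex_inj (mulIg s)); apply: eq_bigr => r _.
rewrite bmRintegralZl// (@prodM (fun i x => g i x * e (s i) x * c ((r * s)%g i) x))//.
rewrite odd_permM; congr (_ * _).
  by rewrite signr_addb mulrCA -signr_addb addbb mulr1.
by apply: eq_bigr => i _; rewrite permM.
Qed.

Lemma moment1 k l : moment (fun=> 1) k l = (k == l)%:R.
Proof. by rewrite -ec; apply: eq_Rintegral => x _; rewrite mul1r. Qed.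

(** The factors at i != a are Kronecker deltas, which force [r] to fix every such i; a permutation
    fixing all points but one is the identity. *)
Lemma integral_one_point f (a : 'I_n) : bounded_measurable f ->
  \int[M]_t (f (tnth t a) * detK t) = \sum_(s : 'S_n) moment f (s a) (s a).
Proof.
move=> bf; pose g i := if i == a then f else fun=> 1.
have bg i : bounded_measurable (g i).
  by rewrite /g; case: ifP => // _; exact: bounded_measurable_cst.
rewrite [LHS](_ : _ = \int[M]_t ((\prod_i g i (tnth t i)) * detK t)).
  rewrite integral_prod_det//; apply: eq_bigr => s _.
  rewrite (bigD1 1%g)//= [X in _ + X]big1 ?addr0 => [|r r1].
    rewrite odd_perm1 expr0 mul1r (bigD1 a)//= big1 ?mulr1 => [|i ia].
      by rewrite /g eqxx perm1.
    by rewrite /g (negbTE ia) perm1 moment1 eqxx.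
  have [i ia ri] : exists2 i, i != a & r i != i.
    apply/exists_inP; apply: contraR r1; rewrite negb_exists_in => /forall_inP H.
    have fixr i : i != a -> r i = i.
      by move=> ia; have := H i ia; rewrite negbK => /eqP.
    apply/eqP/permP => i; rewrite perm1.
    have [->|/fixr//] := eqVneq i a; apply/eqP; apply: contraT => ra.
    by have := fixr _ ra => /perm_inj raa; rewrite raa eqxx in ra.
  rewrite (bigD1 i)//= /g (negbTE ia) moment1 (inj_eq perm_inj) eq_sym (negbTE ri).
  by rewrite mul0r mulr0.
apply: eq_Rintegral => t _; rewrite (bigD1 a)//= big1 ?mulr1 => [|i ia].
  by rewrite /g eqxx.
by rewrite /g (negbTE ia).
Qed.

(** Here the deltas force [r] to fix everything outside a and b, so only the identity and the
    transposition of a and b survive, with opposite signs. *)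
Lemma integral_two_point f g (a b : 'I_n) : a != b ->
  bounded_measurable f -> bounded_measurable g ->
  \int[M]_t (f (tnth t a) * g (tnth t b) * detK t) =
  \sum_(s : 'S_n) (moment f (s a) (s a) * moment g (s b) (s b) -
                   moment f (s a) (s b) * moment g (s b) (s a)).
Proof.
move=> ab bf bg.
pose h i := if i == a then f else if i == b then g else fun=> 1.
have ha : h a = f by rewrite /h eqxx.
have hb : h b = g by rewrite /h eq_sym (negbTE ab) eqxx.
have hi i : i != a -> i != b -> h i = fun=> 1.
  by rewrite /h => /negbTE -> /negbTE ->.
have bh i : bounded_measurable (h i).
  by rewrite /h; do 2 (case: ifP => // _); exact: bounded_measurable_cst.
have ba : b != a by rewrite eq_sym.
rewrite [LHS](_ : _ = \int[M]_t ((\prod_i h i (tnth t i)) * detK t)); last first.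
  apply: eq_Rintegral => t _; rewrite (bigD1 a)//= (bigD1 b)//= ha hb.
  by rewrite [X in _ * (_ * X)]big1 ?mulr1// => i /andP[ia ib]; rewrite hi.
rewrite integral_prod_det//; apply: eq_bigr => s _.
rewrite (bigD1 1%g)//= (bigD1 (tperm a b))/=; last first.
  apply/eqP => /permP/(_ a); rewrite tpermL perm1 => /eqP.
  by rewrite (negbTE ba).
rewrite [X in _ + (_ + X)]big1 ?addr0 => [|r /andP[r1 rab]].
  rewrite odd_perm1 expr0 mul1r odd_tperm ab expr1 mulN1r; congr (_ - _).
    rewrite (bigD1 a)//= (bigD1 b)//= ha hb !perm1 [X in _ * (_ * X)]big1 ?mulr1//.
    by move=> i /andP[ia ib]; rewrite hi// perm1 moment1 eqxx.
  rewrite (bigD1 a)//= (bigD1 b)//= ha hb tpermL tpermR.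
  rewrite [X in _ * (_ * X)]big1 ?mulr1// => i /andP[ia ib].
  by rewrite hi// tpermD 1?eq_sym// moment1 eqxx.
(* Otherwise [r] fixes all other points, hence preserves {a, b}, and is one of the two permutations
   already treated. *)
have [i iab ri] : exists2 i, (i != a) && (i != b) & r i != i.
  apply/exists_inP; apply: contraR rab; rewrite negb_exists_in => /forall_inP H.
  have fixr i : i != a -> i != b -> r i = i.
    by move=> ia ib; have := H i; rewrite ia ib/= negbK => /(_ isT)/eqP.
  have rin x : (x == a) || (x == b) -> (r x == a) || (r x == b).
    move=> xab; apply: contraT; rewrite negb_or => /andP[rxa rxb].
    by have := fixr _ rxa rxb => /perm_inj E; rewrite -E (negbTE rxa) (negbTE rxb) in xab.
  have /rin raE : (a == a) || (a == b) by rewrite eqxx.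
  have /rin rbE : (b == a) || (b == b) by rewrite eqxx orbT.
  have rarb : r a != r b by rewrite (inj_eq perm_inj).
  have [/eqP ra|raNa] := boolP (r a == a).
    suff : r = 1%g by move/eqP; rewrite (negbTE r1).
    apply/permP => i; rewrite perm1.
    have [->//|ia] := eqVneq i a; have [->|ib] := eqVneq i b; last exact: fixr.
    by move: rbE; rewrite -{1}ra eq_sym (negbTE rarb) => /eqP.
  move: raE; rewrite (negbTE raNa)/= => /eqP ra.
  apply/eqP/permP => i.
  have [->|ia] := eqVneq i a; first by rewrite tpermL.
  have [->|ib] := eqVneq i b; last by rewrite tpermD 1?eq_sym// fixr.
  have rbb : r b != b by rewrite -{2}ra eq_sym.
  by rewrite tpermR; move: rbE; rewrite (negbTE rbb) orbF => /eqP.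
have /andP[ia ib] := iab.
rewrite (bigD1 i)//= hi// moment1 (inj_eq perm_inj) eq_sym (negbTE ri).
by rewrite mul0r mulr0.
Qed.

Section law.
Variable nu : probability (n.-tuple T) R.
Hypothesis nuE : forall A, measurable A ->
  nu A = (\int[M]_(t in A) (n`!%:R^-1 * detK t)%:E)%E.

Lemma ensemble_integral (h : n.-tuple T -> R) : bounded_measurable h ->
  \int[nu]_t h t = n`!%:R^-1 * \int[M]_t (h t * detK t).
Proof.
move=> bh; have bd := bounded_measurable_det.
rewrite (@integral_density _ _ _ nu M (fun t => n`!%:R^-1 * detK t))//; last first.
  by apply: bounded_measurableM => //; exact: bounded_measurable_cst.
rewrite -bmRintegralZl; last exact: bounded_measurableM.
by apply: eq_Rintegral => t _; rewrite mulrCA.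
Qed.

Lemma sum_perm_cst (x : R) : n`!%:R^-1 * \sum_(s : 'S_n) x = x.
Proof.
rewrite sumr_const card_Sn -[x *+ _]mulr_natl mulrA mulVf ?mul1r//.
Qed.

Let bmS (f : T -> R) : bounded_measurable f ->
  bounded_measurable (fun t : n.-tuple T => \sum_a f (tnth t a)).
Proof. by move=> bf; apply: bounded_measurable_sum => a; exact: bounded_measurable_tnth. Qed.

(** After summation over the points, each of the n! permutations contributes the same trace, which
    cancels the factor 1/n!. *)
Lemma ensemble_mean (f : T -> R) : bounded_measurable f ->
  \int[nu]_t (\sum_a f (tnth t a)) = \sum_k moment f k k.
Proof.
move=> bf; have bd := bounded_measurable_det; rewrite ensemble_integral; last exact: bmS.
under eq_Rintegral do rewrite mulr_suml.
rewrite bmRintegral_sum; last first.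
  by move=> a; apply: bounded_measurableM => //; exact: bounded_measurable_tnth.
under eq_bigr do rewrite integral_one_point//.
rewrite exchange_big/= -[RHS]sum_perm_cst; congr (_ * _); apply: eq_bigr => s _.
by rewrite [RHS](reindex_inj (@perm_inj _ s)).
Qed.

Lemma ensemble_second_moment (f : T -> R) : bounded_measurable f ->
  \int[nu]_t (\sum_a f (tnth t a)) ^+ 2 =
  \sum_k moment (fun x => f x ^+ 2) k k +
  \sum_k \sum_l (moment f k k * moment f l l - moment f k l * moment f l k).
Proof.
move=> bf; have bd := bounded_measurable_det.
rewrite -ensemble_mean; last exact: bounded_measurableX.
have bft a := bounded_measurable_tnth a bf.
have bff a b : bounded_measurable (fun t : n.-tuple T => f (tnth t a) * f (tnth t b)).
  exact: bounded_measurableM.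
have E t : (\sum_a f (tnth t a)) ^+ 2 = \sum_a f (tnth t a) ^+ 2 +
    \sum_a \sum_(b | b != a) f (tnth t a) * f (tnth t b).
  rewrite expr2 mulr_suml -big_split/=; apply: eq_bigr => a _.
  by rewrite mulr_sumr (bigD1 a)//= -expr2.
under eq_Rintegral do rewrite E.
have bo : bounded_measurable (fun t : n.-tuple T =>
    \sum_a \sum_(b | b != a) f (tnth t a) * f (tnth t b)).
  by do 2 (apply: bounded_measurable_sum => ?).
rewrite bmRintegralD//; last exact: (bmS (bounded_measurableX 2 bf)).
congr (_ + _); rewrite ensemble_integral//.
under eq_Rintegral do rewrite mulr_suml.
rewrite bmRintegral_sum; last first.
  by move=> a; apply: bounded_measurableM => //; exact: bounded_measurable_sum.
have {}E a : \int[M]_t ((\sum_(b | b != a) f (tnth t a) * f (tnth t b)) * detK t) =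
    \sum_(b | b != a) \sum_(s : 'S_n) (moment f (s a) (s a) * moment f (s b) (s b) -
                   moment f (s a) (s b) * moment f (s b) (s a)).
  under eq_Rintegral do rewrite mulr_suml.
  rewrite bmRintegral_sum; last by move=> b; exact: bounded_measurableM.
  by apply: eq_bigr => b ba; rewrite integral_two_point// eq_sym.
under eq_bigr do rewrite E exchange_big.
rewrite exchange_big/= -[RHS]sum_perm_cst; congr (_ * _); apply: eq_bigr => s _.
rewrite [RHS](reindex_inj (@perm_inj _ s)); apply: eq_bigr => a _.
(* The diagonal term l = k of the double sum is zero, so the sum over b != a is the full sum. *)
rewrite [RHS](reindex_inj (@perm_inj _ s)) [RHS](bigD1 a)//=.
by rewrite subrr add0r.
Qed.

Lemma ensemble_variance (f : T -> R) : bounded_measurable f ->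
  \int[nu]_t (\sum_a f (tnth t a) - \int[nu]_t (\sum_a f (tnth t a))) ^+ 2 =
  2^-1 * \int[mu]_x \int[mu]_y ((f x - f y) ^+ 2 * (K x y * K y x)).
Proof.
move=> bf; pose m := \int[nu]_t (\sum_a f (tnth t a)); rewrite -/m; have bS := bmS bf.
(* Both sides equal tr M(f^2) - tr M(f)^2, where M(f) is the matrix [moment f]. *)
transitivity (\sum_k moment (fun x => f x ^+ 2) k k -
    \sum_k \sum_l (moment f k l * moment f l k)).
  transitivity (\int[nu]_t (\sum_a f (tnth t a)) ^+ 2 - m ^+ 2).
    have E t : (\sum_a f (tnth t a) - m) ^+ 2 = (\sum_a f (tnth t a)) ^+ 2 +
        (m ^+ 2 - 2 * m * \sum_a f (tnth t a)) by ring.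
    under eq_Rintegral do rewrite E.
    have bm := bounded_measurable_cst.
    rewrite bmRintegralD; [|exact: bounded_measurableX|
        by apply: bounded_measurableB => //; exact: bounded_measurableM].
    rewrite bmRintegralB//; last exact: bounded_measurableM.
    by rewrite (bmRintegralZl nu (2 * m) bS) -/m Rintegral_cst_probability; ring.
  rewrite ensemble_second_moment// /m ensemble_mean//.
  rewrite -addrA; congr (_ + _).
  rewrite expr2 mulr_suml -sumrB -sumrN; apply: eq_bigr => k _.
  rewrite mulr_sumr -sumrB -sumrN; apply: eq_bigr => l _; ring.
have bkl (f' : T -> R) k l : bounded_measurable f' -> bounded_measurable (fun x => f' x * e k x * c l x).
  by move=> bf'; do 2 (apply: bounded_measurableM => //).
have bf2 := bounded_measurableX 2 bf.
have E x : \int[mu]_y ((f x - f y) ^+ 2 * (K x y * K y x)) =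
    \sum_k \sum_l (((k == l)%:R * (f x ^+ 2 * e k x * c l x)) -
       2 * (moment f l k * (f x * e k x * c l x)) +
       moment (fun x => f x ^+ 2) l k * (1 * e k x * c l x)).
  have {}E y : (f x - f y) ^+ 2 * (K x y * K y x) =
      \sum_k \sum_l ((f x ^+ 2 * e k x * c l x) * (e l y * c k y) -
       (2 * (f x * e k x * c l x)) * (f y * e l y * c k y) +
       (e k x * c l x) * (f y ^+ 2 * e l y * c k y)).
    rewrite /K mulr_suml mulr_sumr; apply: eq_bigr => k _.
    rewrite !mulr_sumr; apply: eq_bigr => l _; ring.
  under eq_Rintegral do rewrite E.
  have b1 k l : bounded_measurable (fun y => f x ^+ 2 * e k x * c l x * (e l y * c k y)).
    by do ?(apply: bounded_measurableM => //); exact: bounded_measurable_cst.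
  have b2 k l : bounded_measurable (fun y => 2 * (f x * e k x * c l x) * (f y * e l y * c k y)).
    by do ?(apply: bounded_measurableM => //); exact: bounded_measurable_cst.
  have b3 k l : bounded_measurable (fun y => e k x * c l x * (f y ^+ 2 * e l y * c k y)).
    by do ?(apply: bounded_measurableM => //); exact: bounded_measurable_cst.
  have b12 k l := bounded_measurableB (b1 k l) (b2 k l).
  have b123 k l := bounded_measurableD (b12 k l) (b3 k l).
  rewrite bmRintegral_sum; last by move=> k; exact: bounded_measurable_sum.
  apply: eq_bigr => k _; rewrite bmRintegral_sum//; apply: eq_bigr => l _.
  rewrite bmRintegralD// bmRintegralB// bmRintegralZl; last exact: bounded_measurableM.
  rewrite !bmRintegralZl ?ec; [|exact: bkl..].
  rewrite -!/(moment _ _ _) eq_sym; ring.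
under eq_Rintegral do rewrite E.
have b1 k l : bounded_measurable (fun x => (k == l)%:R * (f x ^+ 2 * e k x * c l x)).
  by apply: bounded_measurableM; [exact: bounded_measurable_cst|exact: bkl].
have b2 k l : bounded_measurable (fun x => 2 * (moment f l k * (f x * e k x * c l x))).
  by do 2 (apply: bounded_measurableM; first exact: bounded_measurable_cst); exact: bkl.
have b3 k l : bounded_measurable (fun x => moment (fun x => f x ^+ 2) l k * (1 * e k x * c l x)).
  apply: bounded_measurableM; first exact: bounded_measurable_cst.
  exact: (bkl (fun=> 1) k l (bounded_measurable_cst _ _)).
have b12 k l := bounded_measurableB (b1 k l) (b2 k l).
have b123 k l := bounded_measurableD (b12 k l) (b3 k l).
rewrite bmRintegral_sum; last by move=> k; exact: bounded_measurable_sum.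
(* The terms in f(x)^2 and f(y)^2 each give tr M(f^2), by biorthogonality in the other variable;
   this is the 2 that the factor one half removes. *)
transitivity (2^-1 * \sum_k \sum_l ((k == l)%:R * moment (fun x => f x ^+ 2) k k * 2
   - 2 * (moment f k l * moment f l k))).
  rewrite mulr_sumr -sumrB; apply: eq_bigr => k _; rewrite sumrB mulrBr; congr (_ - _).
    rewrite (bigD1 k)//= eqxx big1 ?addr0 => [|l lk].
      by rewrite mul1r mulrCA mulVf ?mulr1.
    by rewrite eq_sym (negbTE lk) !mul0r.
  by rewrite -mulr_sumr mulrA mulVf ?mul1r.
congr (_ * _); apply: eq_bigr => k _; rewrite bmRintegral_sum//; apply: eq_bigr => l _.
rewrite bmRintegralD// bmRintegralB// bmRintegralZl; last exact: bkl.
rewrite bmRintegralZl; last by apply: bounded_measurableM; [exact: bounded_measurable_cst|exact: bkl].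
rewrite bmRintegralZl; last exact: bkl.
rewrite bmRintegralZl; last exact: (bkl (fun=> 1) k l (bounded_measurable_cst _ _)).
rewrite -[\int[mu]_x (1 * _ * _)]/(moment (fun=> 1) k l) moment1 -!/(moment _ _ _).
have [->|_] := eqVneq k l; last by rewrite /=; ring.
rewrite /=; ring.
Qed.

End law.

End biorthogonal_ensemble.

(** * The surface measure *)

Section lebesgue_invariance.
Variables (R : realType) (n : nat).
Local Notation RT := (measurableTypeR R).

Definition tuple_box (A : 'I_n -> set RT) : set (n.-tuple RT) :=
  [set t | forall i, A i (tnth t i)].

Let boxes : set (set (n.-tuple RT)) :=
  [set B | exists2 A : 'I_n -> set RT, (forall i, measurable (A i)) & B = tuple_box A].

Let sigma_boxes : measurable = <<s boxes >>.
Proof.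
apply/seteqP; split.
  apply: smallest_sub; first exact: smallest_sigma_algebra.
  rewrite -bigcup_seq => B [i _ [C mC <-]]; rewrite setTI.
  apply: sub_sigma_algebra; exists (fun j => if j == i then C else setT).
    by move=> j; case: ifP.
  apply/seteqP; split => [t Ct j|t /(_ i)]; last by rewrite eqxx.
  by case: eqVneq => [->|].
apply: smallest_sub; first exact: sigma_algebra_measurable.
by move=> _ [A mA ->]; exact: measurable_tuple_box.
Qed.

(** One common sign is enough: the identity with [b = true] gives the antipode, a transposition with
    [b = false] exchanges two coordinates. *)
Definition signed_perm (s : 'S_n) (b : bool) (t : n.-tuple RT) : n.-tuple RT :=
  [tuple (-1) ^+ b * tnth t (s i) | i < n].

Lemma measurable_signed_perm s b : measurable_fun setT (signed_perm s b).
Proof.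
apply/measurable_fun_tnthP => i.
rewrite (_ : _ \o _ = fun t : n.-tuple RT => (-1) ^+ b * (tnth t (s i) : R)); last first.
  by apply/funext => t /=; rewrite tnth_mktuple.
apply: measurable_funM; first exact: measurable_cst.
exact: measurable_tnth.
Qed.

Let lebesgue_sign (b : bool) (A : set RT) : measurable A ->
  lebesgue_measure [set x : RT | A ((-1) ^+ b * x)] = lebesgue_measure A.
Proof.
case: b => mA.
  rewrite -[RHS]lebesgue_measureN// /pushforward; congr (lebesgue_measure _).
  by apply/seteqP; split => x; rewrite /= [_ * x]mulN1r.
by congr (lebesgue_measure _); apply/seteqP; split => x /=; rewrite expr0 mul1r.
Qed.

(** Boxes form a pi-system generating the sigma-algebra, their preimages are boxes of the same
    volume, and the cubes [-k, k]^n have finite volume and exhaust the space, so uniqueness of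
    measures applies. *)
Lemma lebesgue_power_signed_perm s b B : measurable B ->
  lebesgue_power (signed_perm s b @^-1` B) = lebesgue_power B.
Proof.
have [M eM boxM] := product_power_sigma_finite (@lebesgue_measure R) n.
rewrite /lebesgue_power eM => mB.
have [N eN] := pushforward_measureP M (measurable_signed_perm s b).
have NE A : (forall i, measurable (A i)) -> N (tuple_box A) = M (tuple_box A).
  move=> mA; rewrite -eN /pushforward.
  pose A' j := [set x : RT | A (s^-1 j)%g ((-1) ^+ b * x)].
  rewrite (_ : _ @^-1` _ = tuple_box A'); last first.
    apply/seteqP; split => t /= At i.
      by have := At ((s^-1) i)%g; rewrite tnth_mktuple permKV.
    by have := At (s i); rewrite /A' /= permK tnth_mktuple.
  have mA' i : measurable (A' i).
    rewrite /A' -[X in measurable X]setTI.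
    have mf : measurable_fun [set: RT] (fun x : RT => (-1) ^+ b * x : RT).
      exact: measurable_funM.
    exact: mf.
  rewrite [LHS]boxM// [RHS]boxM// [LHS](reindex_inj (@perm_inj _ s)).
  apply: eq_bigr => i _.
  rewrite -[RHS](lebesgue_sign b (mA i)); congr (lebesgue_measure _).
  by apply/seteqP; split => x; rewrite /A' /= permK.
rewrite -[LHS]/(pushforward M _ B) eN.
apply: (measure_unique boxes (fun k => tuple_box (fun=> `[- k%:R, k%:R]%classic)) sigma_boxes _ _ _ N M) => //.
- move=> _ _ [A mA ->] [A' mA' ->]; exists (fun i => A i `&` A' i).
    by move=> i; exact: measurableI.
  by apply/seteqP; split => [t [At A't] i|t At]; [split|split => i; case: (At i)].
- by move=> k; exists (fun=> `[- k%:R, k%:R]%classic).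
- rewrite -subTset => t _.
  exists (Num.bound (\sum_i `|tnth t i : R|)) => // i.
  rewrite /= in_itv/= -ler_norml.
  apply: le_trans (ltW (archi_boundP _)); last exact: sumr_ge0.
  by rewrite (bigD1 i)//= lerDl sumr_ge0.
- by move=> _ [A mA ->]; exact: NE.
- move=> k; rewrite NE// -ge0_fin_numE// boxM//.
  apply: (big_ind (fun x : \bar R => x \is a fin_num)) => [//|x y|i _].
    exact: fin_numM.
  by have := @lebesgue_measure_itv R `[- k%:R, k%:R]; rewrite /= => ->; case: ifP.
Qed.

End lebesgue_invariance.

Section sphere_measure.
Variables (R : realType) (d : nat).
Local Notation RT := (measurableTypeR R).
Local Notation S := (sphere R d).
Local Notation coord := (@sphere_coord R d).

Lemma measurable_sphere_coord i : measurable_fun setT (coord i).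
Proof.
move=> _ Y mY; rewrite setTI; apply: sub_sigma_algebra => /=.
rewrite -bigcup_seq/=; exists i => /=; first by rewrite mem_index_enum.
by exists Y => //; rewrite setTI.
Qed.

Lemma measurable_fun_sphereP d1 (U : measurableType d1) (f : U -> S) :
  (forall i, measurable_fun setT (coord i \o f)) -> measurable_fun setT f.
Proof.
move=> mf.
suff : preimage_set_system setT f measurable `<=` measurable.
  by move=> H _ A mA; apply: H; exists A.
rewrite [X in preimage_set_system _ _ X](_ : _ = g_sigma_preimage (coord : _ -> _ -> RT))//.
rewrite -g_sigma_preimage_comp; apply: smallest_sub; first exact: sigma_algebra_measurable.
rewrite -bigcup_seq => B [i _ [C mC <-]].
exact: mf.
Qed.

Lemma sphere_coord_sqr_sum (x : S) : \sum_i coord i x ^+ 2 = 1.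
Proof. by rewrite /sphere_coord; case: x => x /= /eqP. Qed.

Lemma sphere_eqP (x y : S) : (forall i, coord i x = coord i y) -> x = y.
Proof.
move=> xy; apply: val_inj; apply/rowP => i; exact: xy.
Qed.

Lemma sphere_coord_le1 i (x : S) : `|coord i x| <= 1.
Proof.
rewrite -(@expr_le1 _ 2)// real_normK ?num_real// -(sphere_coord_sqr_sum x).
by rewrite (bigD1 i)//= lerDl sumr_ge0// => j _; rewrite sqr_ge0.
Qed.

Lemma bounded_measurable_coord i : bounded_measurable (coord i).
Proof.
by split; [exact: measurable_sphere_coord|exists 1 => x; exact: sphere_coord_le1].
Qed.

Definition to_sphere (v : 'rV[R]_d.+1) : S :=
  @odflt S point (insub v : option {x : 'rV[R]_d.+1 | \sum_i x 0 i ^+ 2 == 1}).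

Lemma to_sphereE (v : 'rV[R]_d.+1) i : \sum_i v 0 i ^+ 2 = 1 -> coord i (to_sphere v) = v 0 i.
Proof.
by move=> /eqP v1; rewrite /to_sphere insubT.
Qed.

Definition sqnorm (t : d.+1.-tuple RT) : R := \sum_i (tnth t i : R) ^+ 2.

(** The radial projection t / |t|: the exponent - 1/2 acts on |t|^2. *)
Definition radial (t : d.+1.-tuple RT) : S :=
  if sqnorm t == 0 then point
  else to_sphere (\row_i ((tnth t i : R) * sqnorm t `^ (- 2^-1))).

Lemma measurable_tnthR i : measurable_fun setT (fun t : d.+1.-tuple RT => tnth t i : R).
Proof. exact: measurable_tnth. Qed.

Lemma measurable_sqnorm : measurable_fun setT sqnorm.
Proof.
apply: measurable_sum => i; apply: measurable_funX; exact: measurable_tnthR.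
Qed.

Lemma sqnorm_ge0 t : 0 <= sqnorm t.
Proof. by apply: sumr_ge0 => i _; exact: sqr_ge0. Qed.

Lemma coord_radial t i : sqnorm t != 0 ->
  coord i (radial t) = (tnth t i : R) * sqnorm t `^ (- 2^-1).
Proof.
move=> t0; rewrite /radial (negbTE t0) to_sphereE ?mxE//.
under eq_bigr do rewrite mxE exprMn.
rewrite -mulr_suml -/(sqnorm t) expr2 -powRD ?t0 ?implybT//.
rewrite (_ : - 2^-1 - 2^-1 = -1); last by lra.
by rewrite powR_inv1 ?sqnorm_ge0// mulfV.
Qed.

Lemma measurable_radial : measurable_fun setT radial.
Proof.
apply: measurable_fun_sphereP => i.
rewrite (_ : _ \o _ = fun t => if sqnorm t == 0 then coord i point
    else (tnth t i : R) * sqnorm t `^ (- 2^-1)); last first.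
  by apply/funext => t /=; case: ifPn => [t0|/coord_radial//]; rewrite /radial t0.
apply: measurable_fun_ifT.
- by apply: measurable_fun_eqr => //; exact: measurable_sqnorm.
- exact: measurable_cst.
- apply: measurable_funM; first exact: measurable_tnthR.
  exact: (measurableT_comp (measurable_powR (- 2^-1)) measurable_sqnorm).
Qed.

(** In the definition of [cone] the radius is forced to be |t| and the point to be the radial
    projection of t. Without the existential, measurability and the behaviour under symmetries can
    be read off. *)
Lemma coneE (A : set S) :
  cone A = [set t | 0 < sqnorm t <= 1] `&` radial @^-1` A.
Proof.
apply/seteqP; split => [t [x [r [Ax /andP[r0 r1] tE]]]|t [/= /andP[t0 t1] At]].
  have tr : sqnorm t = r ^+ 2.
    rewrite /sqnorm; under eq_bigr do rewrite tE exprMn.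
    by rewrite -mulr_sumr sphere_coord_sqr_sum mulr1.
  split; first by rewrite /= tr exprn_gt0// expr_le1// ltW.
  rewrite /= (_ : radial t = x)//; apply: sphere_eqP => i.
  have rN0 : r != 0 by rewrite gt_eqF.
  rewrite coord_radial tr ?expf_neq0// tE -powR_mulrn ?ltW// -powRrM mulrN.
  by rewrite mulfV// powR_inv1 ?ltW// mulrAC mulfV// mul1r.
exists (radial t), (sqnorm t `^ 2^-1); split => //.
  by rewrite powR_gt0//= powR12_sqrt ?sqnorm_ge0// -[leRHS]sqrtr1 ler_wsqrtr.
move=> i; rewrite coord_radial ?gt_eqF// powRN mulrCA mulfV ?mulr1//.
by rewrite gt_eqF// powR_gt0.
Qed.

Lemma measurable_cone (A : set S) : measurable A -> measurable (cone A).
Proof.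
move=> mA; rewrite coneE; apply: measurableI.
  rewrite (_ : [set _ | _] = sqnorm @^-1` `]0, 1]%classic); last first.
    by apply/seteqP; split => t; rewrite /= in_itv.
  by rewrite -[X in measurable X]setTI; exact: measurable_sqnorm.
by rewrite -[X in measurable X]setTI; exact: measurable_radial.
Qed.

(** The surface measure is the normalized radial pushforward of Lebesgue measure on the punctured
    unit ball. What has to be shown is that this ball has finite and nonzero volume; it is compared
    with two cubes. *)
Lemma surface_measure_probability :
  exists P : probability S R, @surface_measure R d = P :> (_ -> _).
Proof.
have [M eM boxM] := product_power_sigma_finite (@lebesgue_measure R) d.+1.
pose C := cone [set: S].
have mC : measurable C by exact: measurable_cone.
have CE : C = [set t | 0 < sqnorm t <= 1] by rewrite /C coneE preimage_setT setIT.
have Coo : (M C < +oo)%E.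
  apply: (@le_lt_trans _ _ (M (tuple_box (fun=> `[-1, 1]%classic)))).
    apply: le_measure; rewrite ?inE//; first exact: measurable_tuple_box.
    rewrite CE => t /= /andP[_ t1] i; rewrite /= in_itv/= -ler_norml.
    rewrite -(@expr_le1 _ 2)// real_normK ?num_real//; apply: le_trans t1.
    by rewrite /sqnorm (bigD1 i)//= lerDl sumr_ge0// => j _; rewrite sqr_ge0.
  rewrite -ge0_fin_numE// [X in X \is a fin_num]boxM//.
  apply: (big_ind (fun x : \bar R => x \is a fin_num)) => [//|x y|i _].
    exact: fin_numM.
  by have := @lebesgue_measure_itv R `[- 1, 1]; rewrite /= => ->; case: ifP.
have C0 : (0 < M C)%E.
  (* On this cube each of the d + 1 squares is at most 1/(d + 1), so that their sum is at most 1;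
     leaving 0 out of the interval avoids the origin. *)
  pose B := tuple_box (fun _ : 'I_d.+1 => `]0, d.+1%:R^-1]%classic : set RT).
  apply: (@lt_le_trans _ _ (M B)).
    rewrite [ltRHS]boxM//; apply: (big_ind (fun x : \bar R => (0 < x)%E)) => [|x y|i _].
    - by rewrite lte_fin.
    - exact: mule_gt0.
    - have := @lebesgue_measure_itv R `]0, d.+1%:R^-1]; rewrite /= => ->.
      by rewrite lte_fin invr_gt0 ltr0n/= oppr0 addr0 lte_fin invr_gt0 ltr0n.
  apply: le_measure; rewrite ?inE//; first exact: measurable_tuple_box.
  rewrite CE => t Bt /=; rewrite /sqnorm; apply/andP; split.
    rewrite big_ord_recl ltr_pwDl ?sumr_ge0// => [|i _]; last exact: sqr_ge0.
    by have := Bt ord0; rewrite /= in_itv/= => /andP[? _]; rewrite exprn_gt0.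
  apply: (@le_trans _ _ (\sum_(i < d.+1) d.+1%:R^-1)); last first.
    by rewrite sumr_const card_ord -[_ *+ _]mulr_natl mulfV.
  apply: ler_sum => i _; have := Bt i; rewrite /= in_itv/= => /andP[ti0 ti1].
  rewrite expr2 -[leRHS]mul1r; apply: ler_pM => //; [exact: ltW|exact: ltW|].
  by apply: (le_trans ti1); rewrite invf_le1 ?ltr0n// ler1n.
have mcone := measurable_cone.
have [N eN] := pushforward_measureP (mrestr M mC) measurable_radial.
have NE A : N A = M (cone A).
  by rewrite -eN /pushforward /mrestr coneE setIC; congr (M (_ `&` _)); exact: CE.
(* The point mass is the value of [mnormalize] for zero or infinite mass, which [C0] and [Coo]
   exclude. *)
exists (mnormalize N (\d_(point : S))).
apply/funext => A; rewrite /surface_measure /lebesgue_power eM.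
rewrite /= /mnormalize NE -/C (gt_eqF C0) (lt_eqF Coo)/= NE; congr (_ * _)%E.
have fC : M C \is a fin_num by rewrite ge0_fin_numE.
by rewrite -{1}(fineK fC) inver -/C fine_eq0// gt_eqF.
Qed.

Definition sphere_act (s : 'S_d.+1) (b : bool) (x : S) : S :=
  to_sphere (\row_i ((-1) ^+ b * coord (s i) x)).

Lemma coord_sphere_act s b x i :
  coord i (sphere_act s b x) = (-1) ^+ b * coord (s i) x.
Proof.
rewrite /sphere_act to_sphereE ?mxE//.
under eq_bigr do rewrite mxE exprMn sqrr_sign mul1r.
rewrite -[RHS](sphere_coord_sqr_sum x) [RHS](reindex_inj (@perm_inj _ s)).
by apply: eq_bigr.
Qed.

Lemma measurable_sphere_act s b : measurable_fun setT (sphere_act s b).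
Proof.
apply: measurable_fun_sphereP => i.
rewrite (_ : _ \o _ = fun x => (-1) ^+ b * coord (s i) x); last first.
  by apply/funext => x; exact: coord_sphere_act.
by apply: measurable_funM => //; exact: measurable_sphere_coord.
Qed.

Lemma cone_sphere_act s b (A : set S) :
  cone (sphere_act s b @^-1` A) = signed_perm s b @^-1` cone A.
Proof.
have qE t : sqnorm (signed_perm s b t) = sqnorm t.
  rewrite /sqnorm [RHS](reindex_inj (@perm_inj _ s)); apply: eq_bigr => i _.
  by rewrite tnth_mktuple exprMn sqrr_sign mul1r.
rewrite !coneE preimage_setI; apply/seteqP.
suff E t : 0 < sqnorm t <= 1 -> radial (signed_perm s b t) = sphere_act s b (radial t).
  by split => t /= [t1 At]; rewrite ?qE in t1 *; split => //; move: At; rewrite E.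
move=> /andP[t0 _]; apply: sphere_eqP => i.
rewrite coord_sphere_act !coord_radial ?qE ?gt_eqF//.
by rewrite tnth_mktuple mulrA.
Qed.

Lemma surface_measure_act s b (A : set S) : measurable A ->
  surface_measure (sphere_act s b @^-1` A) = surface_measure A.
Proof.
move=> mA; rewrite /surface_measure cone_sphere_act lebesgue_power_signed_perm//.
exact: measurable_cone.
Qed.

Lemma integral_sphere_act (P : probability S R) s b (f : S -> R) :
  @surface_measure R d = P :> (_ -> _) -> bounded_measurable f ->
  \int[P]_x f (sphere_act s b x) = \int[P]_x f x.
Proof.
move=> eP bf.
have ms := measurable_sphere_act s b.
have [N eN] := pushforward_measureP P ms.
have bfs : bounded_measurable (f \o sphere_act s b).
  by have [mf [M fM]] := bf; split; [exact: measurableT_comp|exists M => x; exact: fM].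
rewrite /Rintegral -[in LHS](@preimage_setT _ _ (sphere_act s b)).
rewrite -(@integral_pushforward _ _ _ _ _ _ ms P _ (EFin \o f))//.
- congr fine; rewrite eN; apply: (eq_measure_integral P) => A mA _.
  rewrite -eN /pushforward.
  transitivity (surface_measure (sphere_act s b @^-1` A)); first by rewrite eP.
  by rewrite surface_measure_act// eP.
- by apply/measurable_EFinP; case: bf.
- by rewrite preimage_setT; exact: bounded_measurable_integrable.
Qed.

End sphere_measure.

(** * Polynomials on the sphere *)

Section polynomials_on_box.
Variable R : realType.

Lemma poly_eq0_on_itv (p : {poly R}) (eps : R) : 0 < eps ->
  (forall z, 0 <= z <= eps -> p.[z] = 0) -> p = 0.
Proof.
move=> e0 p0; apply/eqP; apply: contraT => pN0.
(* These are [size p] distinct points of [0, eps), one more than the degree of p allows as roots. *)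
pose rs := [seq eps * (i%:R / (size p)%:R) | i <- iota 0 (size p)].
have sp : (0 < size p)%N by rewrite lt0n size_poly_eq0.
have rsr : all (root p) rs.
  apply/allP => _ /mapP[i + ->]; rewrite mem_iota add0n => /andP[_ ip].
  apply/eqP; apply: p0; rewrite mulr_ge0 ?divr_ge0 ?(ltW e0)//=.
  by rewrite ger_pMr// ler_pdivrMr ?ltr0n// mul1r ler_nat ltnW.
have urs : uniq rs.
  rewrite map_inj_uniq ?iota_uniq// => i j /(mulfI (lt0r_neq0 e0)).
  have spN0 : ((size p)%:R : R)^-1 != 0 by rewrite invr_eq0 pnatr_eq0 -lt0n.
  by move=> /(mulIf spN0)/eqP; rewrite eqr_nat => /eqP.
by have := max_poly_roots pN0 rsr urs; rewrite size_map size_iota ltnn.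
Qed.

(** Induction on the number of variables: once all variables but the first are fixed, the sum is a
    univariate polynomial vanishing on an interval, so each of its coefficients, a sum of the same
    kind, vanishes on the smaller box. *)
Lemma tuple_poly_eq0_on_box (n m : nat) (eps : R) (c : n.-tuple 'I_m -> R) :
  0 < eps ->
  (forall y : 'I_n -> R, (forall j, 0 <= y j <= eps) ->
     \sum_t c t * \prod_j y j ^+ tnth t j = 0) ->
  forall t, c t = 0.
Proof.
move=> e0; elim: n c => [|n ih] c H t.
  have := H (fun=> 0) (fun j => False_ind _ (notF (ltn_ord j))).
  rewrite (bigD1 t)//= big_ord0 mulr1 big1 ?addr0// => u.
  by rewrite (tuple0 u) (tuple0 t) eqxx.
case/tupleP: t => k u.
apply: (ih (fun u => c [tuple of k :: u])) => y ye.
pose a i := \sum_(u : n.-tuple 'I_m) (c [tuple of i :: u] * \prod_j y j ^+ tnth u j).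
rewrite -/(a k).
(* [\poly] takes coefficients indexed by naturals, hence the passage through [insub]. *)
pose p : {poly R} := \poly_(i < m) (if insub i is Some k then a k else 0).
have pa (i : 'I_m) : p`_i = a i.
  by rewrite coef_poly ltn_ord; case: insubP => [j _ /val_inj->|]; rewrite ?ltn_ord.
rewrite -pa (_ : p = 0) ?coef0//.
apply: (poly_eq0_on_itv e0) => z ze.
have := H (fun j => if unlift ord0 j is Some j' then y j' else z).
have yze j : 0 <= (if unlift ord0 j is Some j' then y j' else z) <= eps by case: unlift.
move=> /(_ yze) <-.
rewrite horner_poly (reindex (@tuple_cons 'I_m n)); last first.
  exists (@tuple_uncons _ n) => v _; [exact: tuple_consK|exact: tuple_unconsK].
rewrite -(pair_bigA _ (fun i v => c (tuple_cons (i, v)) *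
   \prod_j (if unlift ord0 j is Some j' then y j' else z) ^+ tnth (tuple_cons (i, v)) j))/=.
apply: eq_bigr => i _.
case: insubP => [j _ /val_inj ->|]; last by rewrite ltn_ord.
rewrite mulr_suml; apply: eq_bigr => v _; rewrite big_ord_recl unlift_none tnth0 -mulrA.
congr (_ * _); rewrite mulrC; congr (_ * _); apply: eq_bigr => l _.
by rewrite liftK tnthS.
Qed.

End polynomials_on_box.

(** * Dimension of a space of functions *)

Section dimension.
Variables (R : realType) (T : Type).
Implicit Types V : set (T -> R).

Definition is_basis V n (e : 'I_n -> T -> R) :=
  (forall i, V (e i)) /\
  forall f, V f -> exists! c : 'I_n -> R, forall x, f x = \sum_(i < n) c i * e i x.

(** The change-of-basis matrices satisfy A B = 1 by uniqueness of coordinates, and an n x m matrix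
    has a right inverse only if n <= m. *)
Lemma basis_size_le V n m (e : 'I_n -> T -> R) (e' : 'I_m -> T -> R) :
  is_basis V e -> is_basis V e' -> (n <= m)%N.
Proof.
move=> [Ve eP] [Ve' eP'].
have /choice[a aP] : forall i, exists c : 'I_m -> R, forall x, e i x = \sum_j c j * e' j x.
  by move=> i; have [c [cP _]] := eP' _ (Ve i); exists c.
have /choice[b bP] : forall j, exists c : 'I_n -> R, forall x, e' j x = \sum_i c i * e i x.
  by move=> j; have [c [cP _]] := eP _ (Ve' j); exists c.
pose A := \matrix_(i, j) a i j; pose B := \matrix_(j, i) b j i.
suff : A *m B = 1%:M by exact: mulmx1_min.
apply/matrixP => i k; have [c [_ cU]] := eP _ (Ve i).
have -> : (A *m B) i k = c k.
  rewrite (cU (fun k => (A *m B) i k))// => x; rewrite aP.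
  under eq_bigr do rewrite bP mulr_sumr.
  rewrite exchange_big/=; apply: eq_bigr => l _; rewrite mxE mulr_suml.
  by apply: eq_bigr => j _; rewrite !mxE mulrA.
rewrite (cU (fun k => (1%:M : 'M[R]_n) i k))// => x.
rewrite (bigD1 i)//= mxE eqxx mul1r big1 ?addr0// => j ji.
by rewrite mxE eq_sym (negbTE ji) mul0r.
Qed.

Lemma dimensionE V n (e : 'I_n -> T -> R) : is_basis V e -> dimension V = n.
Proof.
move=> be; rewrite /dimension; apply: xget_unique.
  by exists e; case: be.
move=> m [e' Ve' eP']; apply/eqP; rewrite eqn_leq.
by rewrite (basis_size_le be (conj Ve' eP')) (basis_size_le (conj Ve' eP') be).
Qed.

End dimension.

(** * Restrictions of polynomials to the sphere and their normal form *)

Section Pi_space.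
Variables (R : realType) (d : nat).
Local Notation S := (sphere R d).
Local Notation coord := (@sphere_coord R d).
Local Notation Pi := (@Pi_space R d).
Implicit Types (f g : S -> R) (a : 'I_d.+1 -> nat) (L : nat).

Definition monomial a (x : S) : R := \prod_i coord i x ^+ a i.

Lemma Pi_space_monomial L a : (\sum_i a i <= L)%N -> Pi L (monomial a).
Proof.
move=> aL; exists (mpolyX R (Multinom [tuple a i | i < d.+1])).
  rewrite msizeX ltnS mdegE; apply: leq_trans aL; apply: leq_sum => i _.
  by rewrite mnmE.
by move=> x; rewrite mevalX; apply: eq_bigr => i _; rewrite mnmE.
Qed.

Lemma Pi_space0 L : Pi L (fun=> 0).
Proof. by exists 0 => [|x]; rewrite ?msize0// meval0. Qed.

Lemma Pi_spaceD L f g : Pi L f -> Pi L g -> Pi L (fun x => f x + g x).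
Proof.
move=> [p pL fE] [q qL gE]; exists (p + q) => [|x].
  by rewrite (leq_trans (msizeD_le _ _))// geq_max pL.
by rewrite mevalD fE gE.
Qed.

Lemma Pi_spaceZ L (c : R) f : Pi L f -> Pi L (fun x => c * f x).
Proof.
move=> [p pL fE]; exists (c *: p) => [|x]; last by rewrite mevalZ fE.
exact: leq_trans (msizeZ_le _ _) pL.
Qed.

Lemma Pi_spaceB L f g : Pi L f -> Pi L g -> Pi L (fun x => f x - g x).
Proof.
move=> pf pg; rewrite (_ : (fun x => _) = fun x => f x + -1 * g x).
  by apply: Pi_spaceD => //; exact: Pi_spaceZ.
by apply/funext => x; rewrite mulN1r.
Qed.

Lemma Pi_space_sum L I (r : seq I) (P : pred I) (F : I -> S -> R) :
  (forall i, Pi L (F i)) -> Pi L (fun x => \sum_(i <- r | P i) F i x).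
Proof.
move=> pF; elim: r => [|i r ih].
  rewrite (_ : (fun x => _) = fun=> 0); first exact: Pi_space0.
  by apply: funext => x; rewrite big_nil.
rewrite (_ : (fun x => _) = fun x => if P i then F i x + \sum_(j <- r | P j) F j x
    else \sum_(j <- r | P j) F j x); last by apply: funext => x; rewrite big_cons.
by case: (P i) => //; exact: Pi_spaceD.
Qed.

(** Reduces linear properties of functions in [Pi L] to monomials, so that the representing
    polynomial, which is not unique on the sphere, stays out of sight. *)
Lemma Pi_space_ind L (Q : (S -> R) -> Prop) :
  Q (fun=> 0) -> (forall f g, Q f -> Q g -> Q (fun x => f x + g x)) ->
  (forall c f, Q f -> Q (fun x => c * f x)) ->
  (forall a, (\sum_i a i <= L)%N -> Q (monomial a)) ->
  forall f, Pi L f -> Q f.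
Proof.
move=> Q0 QD QZ Qm f [p pL fE].
rewrite (_ : f = fun x => \sum_(m <- msupp p) mcoeff m p * monomial m x); last first.
  by apply/funext => x; rewrite fE mevalE.
have : {subset msupp p <= [pred m : multinom d.+1 | (\sum_i m i <= L)%N]}.
  move=> m /msize_mdeg_lt; rewrite mdegE inE => /leq_trans/(_ pL).
  by rewrite ltnS.
elim: (msupp p) => [_|m s ih sL].
  rewrite (_ : (fun x => _) = fun=> 0)//.
  by apply: funext => x; rewrite big_nil.
rewrite (_ : (fun x => _) = fun x => mcoeff m p * monomial m x +
  \sum_(j <- s) mcoeff j p * monomial j x); last by apply: funext => x; rewrite big_cons.
apply: QD; last by apply: ih => j js; apply: sL; rewrite inE js orbT.
by apply/QZ/Qm; have := sL m; rewrite !inE eqxx => /(_ isT).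
Qed.

Lemma Pi_space_subset L L' : (L <= L')%N -> Pi L `<=` Pi L'.
Proof. by move=> LL' f [p pL fE]; exists p => //; exact: leq_trans pL _. Qed.

Lemma Pi_space_coordM L i f : Pi L f -> Pi L.+1 (fun x => coord i x * f x).
Proof.
move: f; apply: Pi_space_ind => [|f g pf pg|c f pf|a aL].
- rewrite (_ : (fun x => _) = fun=> 0); first exact: Pi_space0.
  by apply/funext => x; rewrite mulr0.
- rewrite (_ : (fun x => _) = fun x => coord i x * f x + coord i x * g x).
    exact: Pi_spaceD.
  by apply/funext => x; rewrite mulrDr.
- rewrite (_ : (fun x => _) = fun x => c * (coord i x * f x)); first exact: Pi_spaceZ.
  by apply/funext => x; rewrite mulrCA.
- rewrite (_ : (fun x => _) = monomial (fun j => (i == j) + a j)%N).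
    apply: Pi_space_monomial; rewrite big_split/= (bigD1 i)//= eqxx big1 ?addn0//.
    by move=> j; rewrite eq_sym => /negbTE ->.
  apply/funext => x; rewrite /monomial; under [RHS]eq_bigr do rewrite exprD.
  rewrite big_split/=; congr (_ * _); rewrite (bigD1 i)//= eqxx expr1 big1 ?mulr1//.
  by move=> j; rewrite eq_sym => /negbTE ->.
Qed.

Lemma bounded_measurable_Pi L f : Pi L f -> bounded_measurable f.
Proof.
move: f; apply: Pi_space_ind => [|f g|c f bf|a _].
- exact: bounded_measurable_cst.
- exact: bounded_measurableD.
- by apply: bounded_measurableM => //; exact: bounded_measurable_cst.
- apply: bounded_measurable_prod => i; apply: bounded_measurableX.
  exact: bounded_measurable_coord.
Qed.

Lemma Pi_space_act L s b f : Pi L f -> Pi L (fun x => f (sphere_act s b x)).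
Proof.
move: f; apply: Pi_space_ind => [|f g|c f|a aL].
- exact: Pi_space0.
- exact: Pi_spaceD.
- exact: Pi_spaceZ.
- rewrite (_ : (fun x => _) = fun x => (\prod_i ((-1) ^+ b) ^+ a i) *
      monomial (fun i => a ((s^-1)%g i)) x).
    apply/Pi_spaceZ/Pi_space_monomial.
    rewrite (reindex_inj (@perm_inj _ s))/=.
    by apply: leq_trans aL; apply: leq_sum => i _; rewrite permK.
  apply/funext => x; rewrite /monomial [X in _ = _ * X](reindex_inj (@perm_inj _ s))/=.
  rewrite -big_split/=; apply: eq_bigr => i _.
  by rewrite coord_sphere_act exprMn permK.
Qed.

Definition antipode (x : S) : S := sphere_act 1%g true x.

Lemma coord_antipode i x : coord i (antipode x) = - coord i x.
Proof. by rewrite coord_sphere_act perm1 expr1 mulN1r. Qed.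

Lemma monomial_antipode a x :
  monomial a (antipode x) = (-1) ^+ (\sum_i a i) * monomial a x.
Proof.
rewrite /monomial -prodrXr.
under eq_bigr do rewrite coord_antipode exprNn.
by rewrite big_split.
Qed.

(** Monomials of degree exactly L + 1 have the parity of L + 1 and cancel; the others already have
    degree at most L. *)
Lemma Pi_space_antipode L f : Pi L.+1 f ->
  Pi L (fun x => f (antipode x) - (-1) ^+ L.+1 * f x).
Proof.
move: f; apply: Pi_space_ind => [|f g pf pg|c f pf|a].
- rewrite (_ : (fun x => _) = fun=> 0); first exact: Pi_space0.
  by apply/funext => x; rewrite mulr0 subrr.
- rewrite (_ : (fun x => _) = fun x => (f (antipode x) - (-1) ^+ L.+1 * f x) +
      (g (antipode x) - (-1) ^+ L.+1 * g x)); first exact: Pi_spaceD.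
  by apply/funext => x; ring.
- rewrite (_ : (fun x => _) = fun x => c * (f (antipode x) - (-1) ^+ L.+1 * f x)).
    exact: Pi_spaceZ.
  by apply/funext => x; ring.
- rewrite leq_eqVlt => /orP[/eqP aL|aL].
    rewrite (_ : (fun x => _) = fun=> 0); first exact: Pi_space0.
    by apply/funext => x; rewrite monomial_antipode aL subrr.
  rewrite (_ : (fun x => _) = fun x => ((-1) ^+ (\sum_i a i) - (-1) ^+ L.+1) * monomial a x).
    exact/Pi_spaceZ/Pi_space_monomial.
  by apply/funext => x; rewrite monomial_antipode mulrBl.
Qed.

Lemma Pi_space0_cst f : Pi 0 f -> exists c, f = fun=> c.
Proof.
move: f; apply: Pi_space_ind => [|f g [c ->] [c' ->]|c f [c' ->]|a].
- by exists 0.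
- by exists (c + c').
- by exists (c * c').
- rewrite leqn0 sum_nat_eq0 => /forallP a0; exists 1; apply/funext => x.
  by rewrite /monomial big1// => i _; rewrite (eqP (a0 i)) expr0.
Qed.

(** Exponents of the normal forms modulo the equation of the sphere: the boolean is the exponent of
    x_0, the tuple holds the others. Bounding its entries by L makes the index type finite and loses
    nothing, as the total degree is at most L. *)
Definition reduced_index L : {set bool * d.-tuple 'I_L.+1} :=
  [set bt : bool * d.-tuple 'I_L.+1 | (bt.1 + \sum_(i <- bt.2) i <= L)%N]%SET.

Definition reduced_monomial L (bt : bool * d.-tuple 'I_L.+1) (x : S) : R :=
  coord ord0 x ^+ bt.1 * \prod_(j < d) coord (lift ord0 j) x ^+ tnth bt.2 j.

Lemma reduced_monomialE L (bt : bool * d.-tuple 'I_L.+1) : reduced_monomial bt =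
  monomial (fun i => if unlift ord0 i is Some j then tnth bt.2 j else bt.1).
Proof.
apply/funext => x; rewrite /monomial big_ord_recl unlift_none.
by congr (_ * _); apply: eq_bigr => j _; rewrite liftK.
Qed.

Lemma Pi_space_reduced_monomial L bt : bt \in reduced_index L -> Pi L (reduced_monomial bt).
Proof.
rewrite inE => btL; rewrite reduced_monomialE; apply: Pi_space_monomial.
apply: leq_trans btL; rewrite big_ord_recl unlift_none leq_add2l big_tuple.
by apply: leq_sum => j _; rewrite liftK.
Qed.

(* The equation of the sphere lowers the exponent of x_0 by two. *)
Lemma monomial_reduction a x : (1 < a ord0)%N ->
  let a' i := if i == ord0 then (a i - 2)%N else a i in
  monomial a x = monomial a' x -
    \sum_(j < d) monomial (fun i => (a' i + (i == lift ord0 j).*2)%N) x.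
Proof.
move=> a0 a'.
have E j : monomial (fun i => (a' i + (i == lift ord0 j).*2)%N) x =
    monomial a' x * coord (lift ord0 j) x ^+ 2.
  rewrite /monomial; under eq_bigr do rewrite exprD.
  rewrite big_split/=; congr (_ * _); rewrite (bigD1 (lift ord0 j))//= eqxx.
  by rewrite big1 ?mulr1// => i /negbTE ->.
under eq_bigr do rewrite E.
rewrite -mulr_sumr -{1}[monomial a' x]mulr1 -mulrBr.
have := sphere_coord_sqr_sum x; rewrite big_ord_recl => /(canRL (addrK _)) <-.
rewrite /monomial big_ord_recl [in RHS]big_ord_recl.
rewrite mulrAC /a' eqxx -exprD subnK//; congr (_ * _).
Qed.

Lemma Pi_space_reduced L f : Pi L f -> exists c : bool * d.-tuple 'I_L.+1 -> R,
  forall x, f x = \sum_(bt in reduced_index L) c bt * reduced_monomial bt x.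
Proof.
move: f; apply: Pi_space_ind => [|f g [c cE] [c' cE']|k f [c cE]|a].
- by exists (fun=> 0) => x; rewrite big1// => i _; rewrite mul0r.
- exists (fun bt => c bt + c' bt) => x; rewrite cE cE' -big_split/=.
  by apply: eq_bigr => bt _; rewrite mulrDl.
- exists (fun bt => k * c bt) => x; rewrite cE mulr_sumr.
  by apply: eq_bigr => bt _; rewrite mulrA.
(* Induction on the exponent of x_0: the equation of the sphere yields monomials of no larger degree
   in which this exponent has dropped by two. *)
have [n] := ubnP (a ord0); elim: n a => // n ih a an aL.
have [a1|a1] := leqP (a ord0) 1.
  pose bt : bool * d.-tuple 'I_L.+1 :=
    (a ord0 == 1%N, [tuple inord (a (lift ord0 j)) | j < d]).
  have aj j : (a (lift ord0 j) < L.+1)%N.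
    by rewrite ltnS; apply: leq_trans aL; rewrite (bigD1 (lift ord0 j))//= leq_addr.
  have a0E : bt.1 = a ord0 :> nat by rewrite /bt/=; case: (a ord0) a1 => [|[]].
  have btL : bt \in reduced_index L.
    rewrite inE a0E big_tuple; apply: leq_trans aL; rewrite [leqRHS]big_ord_recl leq_add2l.
    by apply: leq_sum => j _; rewrite tnth_mktuple inordK.
  exists (fun i => (i == bt)%:R) => x.
  rewrite (bigD1 bt)//= eqxx mul1r big1 ?addr0.
    rewrite /monomial big_ord_recl /reduced_monomial a0E; congr (_ * _).
    by apply: eq_bigr => j _; rewrite tnth_mktuple inordK.
  by move=> i /andP[_ /negbTE ->]; rewrite mul0r.
pose a' i := if i == ord0 then (a i - 2)%N else a i.
have a'L : (\sum_i a' i + 2 = \sum_i a i)%N.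
  rewrite big_ord_recl [RHS]big_ord_recl /a' eqxx addnAC subnK//.
have a'0 : (a' ord0 < n)%N.
  by rewrite /a' eqxx; apply: (@leq_trans (a ord0)) => //; rewrite ltn_subrL (ltnW a1).
have a'leL : (\sum_i a' i <= L)%N by apply: leq_trans aL; rewrite -a'L leq_addr.
have [c cE] := ih a' a'0 a'leL.
have /choice[c' cE'] : forall j, exists c : bool * d.-tuple 'I_L.+1 -> R, forall x,
    monomial (fun i => (a' i + (i == lift ord0 j).*2)%N) x =
    \sum_(bt in reduced_index L) c bt * reduced_monomial bt x.
  move=> j; apply: ih.
    by rewrite (negbTE (neq_lift _ _)) addn0.
  rewrite big_split/= [X in (_ + X)%N](_ : _ = 2) ?a'L//.
  by rewrite (bigD1 (lift ord0 j))//= eqxx big1 ?addn0// => i /negbTE ->.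
exists (fun bt => c bt - \sum_(j < d) c' j bt) => x.
have -> : monomial a x = monomial a' x -
    \sum_(j < d) monomial (fun i => (a' i + (i == lift ord0 j).*2)%N) x.
  exact: monomial_reduction.
rewrite cE (eq_bigr (fun j => \sum_(bt in reduced_index L) c' j bt * reduced_monomial bt x));
  last by move=> j _; exact: cE'.
rewrite exchange_big/= -sumrB; apply: eq_bigr => bt _.
by rewrite mulrBl mulr_suml.
Qed.

End Pi_space.

(** * An explicit basis of the polynomial space and its cardinality *)

Section Pi_dimension.
Variables (R : realType) (d : nat).
Local Notation S := (sphere R d).
Local Notation coord := (@sphere_coord R d).
Local Notation Pi := (@Pi_space R d).

(* Evaluate at the two points of the sphere above a given point of the
   equatorial ball to separate the terms with and without x_0. *)
Lemma reduced_monomial_free L (c : bool * d.-tuple 'I_L.+1 -> R) :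
  (forall x, \sum_(bt in reduced_index d L) c bt * reduced_monomial bt x = 0) ->
  forall bt, bt \in reduced_index d L -> c bt = 0.
Proof.
move=> H.
pose C (b : bool) (t : d.-tuple 'I_L.+1) := if (b, t) \in reduced_index d L then c (b, t) else 0.
suff C0 b t : C b t = 0 by move=> [b t] btL; have := C0 b t; rewrite /C btL.
pose P b (y : 'I_d -> R) := \sum_t C b t * \prod_j y j ^+ tnth t j.
(* The squares of d numbers of [0, 1/(d + 1)] add up to less than 1, so the height [r] of the two
   points above [y] is positive and can be cancelled. *)
pose eps : R := d.+1%:R^-1.
have eps0 : 0 < eps by rewrite invr_gt0 ltr0n.
apply: (tuple_poly_eq0_on_box eps0) => y ye; rewrite -/(P b y).
pose s := \sum_j y j ^+ 2.
have s1 : s < 1.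
  apply: (@le_lt_trans _ _ (\sum_(j < d) eps)).
    apply: ler_sum => j _; have /andP[y0 y1] := ye j.
    rewrite expr2 -[leRHS]mul1r; apply: ler_pM => //.
    by apply: (le_trans y1); rewrite /eps invf_le1 ?ltr0n// ler1n.
  by rewrite sumr_const card_ord -[_ *+ _]mulr_natl ltr_pdivrMr ?ltr0n// mul1r ltr_nat.
pose r := Num.sqrt (1 - s).
have r0 : 0 < r by rewrite sqrtr_gt0 subr_gt0.
pose v (e : bool) : 'rV[R]_d.+1 :=
  \row_i (if unlift ord0 i is Some j then y j else (-1) ^+ e * r).
have vE (e : bool) : P false y + (-1) ^+ e * r * P true y = 0.
  rewrite -[RHS](H (to_sphere (v e))) big_mkcond/=.
  have cv i : coord i (to_sphere (v e)) = v e 0 i.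
    apply: to_sphereE; rewrite big_ord_recl mxE unlift_none exprMn sqrr_sign mul1r.
    rewrite sqr_sqrtr ?subr_ge0 ?(ltW s1)//.
    under eq_bigr do rewrite mxE liftK.
    by rewrite subrK.
  transitivity (\sum_b \sum_t (if (b, t) \in reduced_index d L then
      c (b, t) * reduced_monomial (b, t) (to_sphere (v e)) else 0)); last first.
    by rewrite pair_bigA; apply: eq_bigr => -[].
  rewrite big_bool /= [RHS]addrC; congr (_ + _).
    apply: eq_bigr => u _; rewrite /C; case: ifP => _; last by rewrite mul0r.
    rewrite /reduced_monomial expr0 mul1r; congr (_ * _).
    by apply: eq_bigr => j _; rewrite cv mxE liftK.
  rewrite /P mulr_sumr; apply: eq_bigr => u _; rewrite /C; case: ifP => _; last by rewrite mul0r mulr0.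
  rewrite /reduced_monomial cv mxE unlift_none expr1 mulrCA; congr (_ * (_ * _)).
  by apply: eq_bigr => j _; rewrite cv mxE liftK.
have := vE false; have := vE true; rewrite expr1 expr0 mul1r => E1 E2.
have rP : r * P true y = 0 by move: E1 E2; rewrite mulN1r mulNr; lra.
case: b; last by move: E2; rewrite rP addr0.
by move/eqP: rP; rewrite mulf_eq0 gt_eqF//= => /eqP.
Qed.

Lemma reduced_basis L :
  is_basis (Pi L) (fun k : 'I_#|reduced_index d L| => reduced_monomial (R := R) (enum_val k)).
Proof.
split=> [k|f pf]; first by apply: Pi_space_reduced_monomial; exact: enum_valP.
have [c cE] := Pi_space_reduced pf.
exists (c \o enum_val); split => [x|c' c'E]; first by rewrite cE big_enum_val.
(* Extends the difference of the two coordinate families from ordinals to all exponents, the form in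
   which freeness is stated. *)
pose D bt := \sum_k (enum_val k == bt)%:R * (c (enum_val k) - c' k).
have DE k : D (enum_val k) = c (enum_val k) - c' k.
  rewrite /D (bigD1 k)//= eqxx mul1r big1 ?addr0// => l lk.
  by rewrite (inj_eq enum_val_inj) (negbTE lk) mul0r.
apply/funext => k; apply/eqP; rewrite /= -subr_eq0 -DE.
apply/eqP; apply: (reduced_monomial_free (c := D)); last exact: enum_valP.
move=> x; rewrite big_enum_val; under eq_bigr do rewrite DE mulrBl.
by rewrite sumrB -c'E cE [X in _ - X]big_enum_val subrr.
Qed.

End Pi_dimension.

(** Exponent 0 of x_0 leaves the tuples of sum at most L, exponent 1 those of sum less than L. The
    second count is the first minus the tuples of sum exactly L, that is C(d+1+L, d+1) - C(d+L, d),
    and Pascal's rule concludes. *)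
Lemma card_reduced_index d L :
  #|reduced_index d.+1 L| = ('C(d.+1 + L, d.+1) + 'C(d + L, d.+1))%N.
Proof.
pose le := [set t : d.+1.-tuple 'I_L.+1 | (\sum_(i <- t) i <= L)%N]%SET.
pose lt := [set t : d.+1.-tuple 'I_L.+1 | (\sum_(i <- t) i < L)%N]%SET.
pose eq := [set t : d.+1.-tuple 'I_L.+1 | (\sum_(i <- t) i == L)%N]%SET.
have cle : #|le| = 'C(d.+1 + L, d.+1) := card_partial_ord_partitions d.+1 L.
have clt : (#|lt| + 'C(d + L, d))%N = 'C(d.+1 + L, d.+1).
  rewrite -cle -card_ord_partitions -/eq -(cardsID lt le); congr (_ + _)%N.
    by apply: eq_card => t; rewrite !inE andb_idl// => /ltnW.
  by apply: eq_card => t; rewrite !inE -leqNgt andbC eqn_leq.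
have -> : #|reduced_index d.+1 L| = (#|le| + #|lt|)%N.
  rewrite -!sum1_card big_mkcond/= [X in _ = (X + _)%N]big_mkcond/=.
  rewrite [X in _ = (_ + X)%N]big_mkcond/=.
  transitivity (\sum_b \sum_(t : d.+1.-tuple 'I_L.+1)
    (if (b, t) \in reduced_index d.+1 L then 1 else 0))%N.
    by rewrite pair_bigA; apply: eq_bigr => -[].
  rewrite big_bool/= addnC.
  by congr (_ + _)%N; apply: eq_bigr => t _; rewrite !inE.
rewrite cle; congr (_ + _)%N; apply/eqP; rewrite -(eqn_add2r 'C(d + L, d)) clt.
by rewrite addSn binS.
Qed.

(** With D = d + 1 this is (2L + D)/D times C(D + L - 1, L), in a form suited to Pascal's rule. *)
Lemma pi_dimE (R : realType) d L :
  pi_dim R d.+1 L = ('C(d.+1 + L, d.+1) + 'C(d + L, d.+1))%N.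
Proof. by rewrite /pi_dim (dimensionE (reduced_basis R d.+1 L)) card_reduced_index. Qed.

(** Indexing by [pi_dim] gives the basis as many elements as the random tuple has points, as the
    factorization of the determinant requires. *)
Lemma Pi_space_basis (R : realType) d L :
  exists e : 'I_(pi_dim R d L) -> sphere R d -> R, is_basis (@Pi_space R d L) e.
Proof.
rewrite /pi_dim (dimensionE (reduced_basis R d L)).
by exists (fun k => reduced_monomial (enum_val k)); exact: reduced_basis.
Qed.

(** * Reproducing kernels *)

Section kernel.
Variables (R : realType) (d : nat) (mu : probability (sphere R d) R).
Local Notation S := (sphere R d).
Local Notation coord := (@sphere_coord R d).
Local Notation Pi := (@Pi_space R d).
Variables (L : nat) (K : S -> S -> R).
Hypothesis hK : reproducing_kernel mu (Pi L) K.

Lemma kernel_Pi x : Pi L (K x). Proof. exact: hK.1. Qed.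

Lemma bounded_measurable_kernel x : bounded_measurable (K x).
Proof. exact/bounded_measurable_Pi/kernel_Pi. Qed.

Lemma kernel_reproducing f x : Pi L f -> \int[mu]_y (f y * K x y) = f x.
Proof. by move=> pf; rewrite /Rintegral -(hK.2 f pf x). Qed.

Lemma kernel_sym x y : K x y = K y x.
Proof.
rewrite -(kernel_reproducing y (kernel_Pi x)) -(kernel_reproducing x (kernel_Pi y)).
by apply: eq_Rintegral => z _; rewrite mulrC.
Qed.

Lemma kernel_sqr x : \int[mu]_y (K x y ^+ 2) = K x x.
Proof.
rewrite -[RHS](kernel_reproducing x (kernel_Pi x)).
by apply: eq_Rintegral => y _; rewrite expr2.
Qed.

(** Testing [f] against [K x] returns f x; this is nondegeneracy of the L^2 pairing on [Pi L]. *)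
Lemma Pi_orthogonal_eq0 f : Pi L f ->
  (forall g, Pi L g -> \int[mu]_y (f y * g y) = 0) -> forall x, f x = 0.
Proof. by move=> pf H x; rewrite -(kernel_reproducing x pf); apply/H/kernel_Pi. Qed.

(** The dual basis is the inverse Gram matrix applied to [e], so any basis will do and no
    orthonormalization takes place. *)
Lemma kernel_biorthogonal n (e : 'I_n -> S -> R) : is_basis (Pi L) e ->
  exists c : 'I_n -> S -> R, [/\ forall k, Pi L (c k),
    forall k l, \int[mu]_x (e k x * c l x) = (k == l)%:R &
    forall x y, K x y = \sum_k e k x * c k y].
Proof.
move=> [Ve eP]; pose G := \matrix_(k, l) \int[mu]_x (e k x * e l x).
have be k := bounded_measurable_Pi (Ve k).
have bee k l := bounded_measurableM (be k) (be l).
(* A vector in the kernel of [G] gives a function of [Pi L] orthogonal to the basis, hence zero,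
   hence with zero coordinates. *)
have Gu : G \in unitmx.
  rewrite -row_free_unit; apply: inj_row_free => v vG.
  pose f x := \sum_k v 0 k * e k x.
  have pf : Pi L f by apply: Pi_space_sum => k; exact: Pi_spaceZ.
  have f0 : forall x, f x = 0.
    apply: Pi_orthogonal_eq0 => // g pg; have [c [cE _]] := eP _ pg.
    have fe l : \int[mu]_y (f y * e l y) = 0.
      have := congr1 (fun A : 'rV_n => A 0 l) vG; rewrite !mxE => vGl.
      rewrite -[RHS]vGl /f; under eq_Rintegral do rewrite mulr_suml.
      rewrite bmRintegral_sum; last first.
        move=> k; apply: bounded_measurableM => //; apply: bounded_measurableM => //.
        exact: bounded_measurable_cst.
      apply: eq_bigr => k _; rewrite mxE -bmRintegralZl//.
      by apply: eq_Rintegral => x _; rewrite mulrA.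
    have bfe l : bounded_measurable (fun y => f y * e l y).
      by apply: bounded_measurableM => //; exact: bounded_measurable_Pi pf.
    transitivity (\int[mu]_y \sum_l c l * (f y * e l y)).
      apply: eq_Rintegral => y _; rewrite cE mulr_sumr; apply: eq_bigr => l _.
      by rewrite mulrCA.
    rewrite bmRintegral_sum; last first.
      by move=> l; apply: bounded_measurableM => //; exact: bounded_measurable_cst.
    by rewrite big1// => l _; rewrite bmRintegralZl// fe mulr0.
  have [c [_ cU]] := eP _ (Pi_space0 R d L).
  have c0 : c = fun=> 0 by apply: cU => x; rewrite big1// => k _; rewrite mul0r.
  have cv : c = v 0 by apply: cU => x; rewrite -[LHS](f0 x).
  by apply/rowP => k; rewrite mxE -cv c0.
pose c l x := \sum_k invmx G l k * e k x.
have Vc l : Pi L (c l) by apply: Pi_space_sum => k; exact: Pi_spaceZ.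
exists c; split => // [k l|x y].
  rewrite (_ : (k == l)%:R = (invmx G *m G) l k); last by rewrite mulVmx// mxE eq_sym.
  rewrite mxE /c; under eq_Rintegral do rewrite mulr_sumr.
  have bc j : bounded_measurable (fun x => e k x * (invmx G l j * e j x)).
    by do 2 (apply: bounded_measurableM => //); exact: bounded_measurable_cst.
  rewrite bmRintegral_sum//; apply: eq_bigr => j _; rewrite mxE -bmRintegralZl//.
  by apply: eq_Rintegral => x _; ring.
have [b [bE _]] := eP _ (kernel_Pi y).
(* Reproducing each [e l] at y shows that the coordinates [b] of [K y] solve G b = e(y), so that b =
   c(y). *)
have GbE l : e l y = \sum_k G l k * b k.
  rewrite -(kernel_reproducing y (Ve l)).
  transitivity (\int[mu]_x \sum_k (e l x * e k x * b k)).
    apply: eq_Rintegral => x' _; rewrite bE mulr_sumr; apply: eq_bigr => k _; ring.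
  rewrite bmRintegral_sum; last first.
    by move=> k; apply: bounded_measurableM => //; exact: bounded_measurable_cst.
  by apply: eq_bigr => k _; rewrite bmRintegralZr// mxE.
have cb k : c k y = b k.
  have -> : c k y = (invmx G *m (G *m \col_l b l)) k 0.
    rewrite mxE; apply: eq_bigr => l _; rewrite GbE [(G *m _) l 0]mxE; congr (_ * _).
    by apply: eq_bigr => j _; rewrite [X in _ = _ * X]mxE.
  by rewrite mulKmx// mxE.
by rewrite kernel_sym bE; apply: eq_bigr => k _; rewrite cb mulrC.
Qed.

Lemma bounded_measurable_kernel_diag : bounded_measurable (fun x => K x x).
Proof.
have [e be] := Pi_space_basis R d L.
have [c [Vc _ KE]] := kernel_biorthogonal be.
rewrite (_ : (fun x => _) = fun x => \sum_k e k x * c k x); last by apply/funext => x.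
apply: bounded_measurable_sum => k; apply: bounded_measurableM.
  exact: bounded_measurable_Pi (be.1 k).
exact: bounded_measurable_Pi (Vc k).
Qed.

Lemma kernel_trace : \int[mu]_x K x x = (pi_dim R d L)%:R.
Proof.
have [e be] := Pi_space_basis R d L.
have [c [Vc ec KE]] := kernel_biorthogonal be.
under eq_Rintegral do rewrite KE.
rewrite bmRintegral_sum; last first.
  by move=> k; apply: bounded_measurableM; apply: bounded_measurable_Pi;
    [exact: be.1|exact: Vc].
under eq_bigr do rewrite ec eqxx.
by rewrite sumr_const card_ord.
Qed.

(** Expanded over a basis and its dual, the integral is a finite combination of products e_k(x)
    e_l(x) with constant coefficients, so its measurability in x is immediate. *)
Lemma bounded_measurable_kernel_sqr (g : S -> R) : bounded_measurable g ->
  bounded_measurable (fun x => \int[mu]_y (g y * K x y ^+ 2)).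
Proof.
move=> bg; have [e be] := Pi_space_basis R d L.
have [c [Vc _ KE]] := kernel_biorthogonal be.
have bc k := bounded_measurable_Pi (Vc k).
rewrite (_ : (fun x => _) = fun x => \sum_k \sum_l
    e k x * e l x * \int[mu]_y (g y * (c k y * c l y))); last first.
  apply/funext => x.
  transitivity (\int[mu]_y \sum_k \sum_l (e k x * e l x * (g y * (c k y * c l y)))).
    apply: eq_Rintegral => y _; rewrite KE expr2 mulr_suml mulr_sumr.
    apply: eq_bigr => k _; rewrite !mulr_sumr; apply: eq_bigr => l _; ring.
  have bkl k l : bounded_measurable (fun y => g y * (c k y * c l y)).
    by do 2 (apply: bounded_measurableM => //).
  have bkl' k l : bounded_measurable (fun y => e k x * e l x * (g y * (c k y * c l y))).
    by apply: bounded_measurableM => //; exact: bounded_measurable_cst.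
  rewrite bmRintegral_sum; last by move=> k; exact: bounded_measurable_sum.
  apply: eq_bigr => k _; rewrite bmRintegral_sum//; apply: eq_bigr => l _.
  by rewrite bmRintegralZl.
do 2 (apply: bounded_measurable_sum => ?).
apply: bounded_measurableM; last exact: bounded_measurable_cst.
by apply: bounded_measurableM; exact: bounded_measurable_Pi (be.1 _).
Qed.

Lemma inner_varianceE f x : bounded_measurable f ->
  \int[mu]_y ((f x - f y) ^+ 2 * K x y ^+ 2) =
  f x ^+ 2 * K x x - 2 * f x * \int[mu]_y (f y * K x y ^+ 2) +
  \int[mu]_y (f y ^+ 2 * K x y ^+ 2).
Proof.
move=> bf; have bK := bounded_measurable_kernel x.
have bK2 := bounded_measurableX 2 bK; have bf2 := bounded_measurableX 2 bf.
transitivity (\int[mu]_y (f x ^+ 2 * K x y ^+ 2 - 2 * f x * (f y * K x y ^+ 2) +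
    f y ^+ 2 * K x y ^+ 2)).
  by apply: eq_Rintegral => y _; ring.
have b1 : bounded_measurable (fun y => f x ^+ 2 * K x y ^+ 2).
  by apply: bounded_measurableM => //; exact: bounded_measurable_cst.
have b2 : bounded_measurable (fun y => f y * K x y ^+ 2) by exact: bounded_measurableM.
have b3 : bounded_measurable (fun y => 2 * f x * (f y * K x y ^+ 2)).
  by apply: bounded_measurableM => //; exact: bounded_measurable_cst.
rewrite bmRintegralD ?bmRintegralB//; last 2 first.
- exact: bounded_measurableB.
- exact: bounded_measurableM.
by rewrite (bmRintegralZl mu _ bK2) (bmRintegralZl mu _ b2) kernel_sqr.
Qed.

Lemma bounded_measurable_inner_variance f : bounded_measurable f ->
  bounded_measurable (fun x => \int[mu]_y ((f x - f y) ^+ 2 * K x y ^+ 2)).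
Proof.
move=> bf; rewrite (funext (fun x => inner_varianceE x bf)).
have bc := bounded_measurable_cst.
have bf2 := bounded_measurableX 2 bf.
apply: bounded_measurableD; last exact: bounded_measurable_kernel_sqr.
apply: bounded_measurableB.
  by apply: bounded_measurableM => //; exact: bounded_measurable_kernel_diag.
apply: bounded_measurableM; last exact: bounded_measurable_kernel_sqr.
exact: bounded_measurableM.
Qed.

Definition variance_form (f : S -> R) : R :=
  2^-1 * \int[mu]_x \int[mu]_y ((f x - f y) ^+ 2 * K x y ^+ 2).

End kernel.

(** * The recursion in L and the symmetries of the kernels *)

Section kernel_sequence.
Variables (R : realType) (d : nat) (mu : probability (sphere R d) R).
Hypothesis emu : @surface_measure R d = mu :> (_ -> _).
Local Notation S := (sphere R d).
Local Notation coord := (@sphere_coord R d).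
Local Notation Pi := (@Pi_space R d).
Variable K : nat -> S -> S -> R.
Hypothesis hK : forall L, reproducing_kernel mu (Pi L) (K L).

Let bK L x := bounded_measurable_kernel (hK L) x.
Let bcoord := @bounded_measurable_coord R d.

(* W_L(x) = \int x.y K_L(x,y)^2 dy *)
Let W L x := \sum_i coord i x * \int[mu]_y (coord i y * K L x y ^+ 2).

Lemma integral_antipode (f : S -> R) : bounded_measurable f ->
  \int[mu]_x f (antipode x) = \int[mu]_x f x.
Proof. exact: integral_sphere_act. Qed.

Lemma integral_antipode_odd (f : S -> R) : bounded_measurable f ->
  (forall x, f (antipode x) = - f x) -> \int[mu]_x f x = 0.
Proof.
move=> bf fodd; have := integral_antipode bf.
under eq_Rintegral do rewrite fodd -mulN1r.
rewrite bmRintegralZl// mulN1r; lra.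
Qed.

(** The increment Z is orthogonal to [Pi L], and so is its composition with the antipode, which
    preserves mu and [Pi L]. The difference of the two sides thus lies in [Pi L] by
    [Pi_space_antipode] and is orthogonal to it. *)
Lemma kernel_increment_antipode L x y :
  K L.+1 x (antipode y) - K L x (antipode y) =
  (-1) ^+ L.+1 * (K L.+1 x y - K L x y).
Proof.
pose Z y := K L.+1 x y - K L x y; rewrite -/(Z y) -/(Z (antipode y)).
have PK : Pi L.+1 (K L x) by apply: (Pi_space_subset (leqnSn L)); exact: kernel_Pi (hK L) x.
have PZ : Pi L.+1 Z by apply: Pi_spaceB => //; exact: kernel_Pi (hK L.+1) x.
have PZa := Pi_space_antipode PZ.
have bZ := bounded_measurable_Pi PZ.
have Zort g : Pi L g -> \int[mu]_y (g y * Z y) = 0.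
  move=> pg; under eq_Rintegral do rewrite mulrBr.
  have bg := bounded_measurable_Pi pg.
  rewrite bmRintegralB; [|exact: bounded_measurableM..].
  rewrite (kernel_reproducing (hK L) x pg).
  by rewrite (kernel_reproducing (hK L.+1) x (Pi_space_subset (leqnSn L) pg)) subrr.
apply/eqP; rewrite -subr_eq0; apply/eqP; move: y.
apply: (Pi_orthogonal_eq0 (hK L) PZa) => g pg.
have bg := bounded_measurable_Pi pg.
have PgA : Pi L (fun y => g (antipode y)) by exact: Pi_space_act.
have bgA := bounded_measurable_Pi PgA.
have bZA : bounded_measurable (fun y => Z (antipode y)).
  by apply: (@bounded_measurable_Pi _ _ L.+1); exact: Pi_space_act.
transitivity (\int[mu]_y (g y * Z (antipode y) - (-1) ^+ L.+1 * (g y * Z y))).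
  by apply: eq_Rintegral => y _; ring.
have bgZ := bounded_measurableM bg bZ.
rewrite bmRintegralB; [|exact: bounded_measurableM|]; last first.
  by apply: bounded_measurableM => //; exact: bounded_measurable_cst.
rewrite bmRintegralZl// Zort// mulr0 subr0 -(Zort _ PgA).
have aa y : antipode (antipode y) = y.
  by apply: sphere_eqP => i; rewrite !coord_antipode opprK.
rewrite -(integral_antipode (bounded_measurableM bg bZA)).
by apply: eq_Rintegral => y _; rewrite aa.
Qed.

Lemma weighted_kernel_rec L x : W L.+1 x = 2 * K L x x - W L x.
Proof.
(* Inserting 1 = \sum_i x_i^2 reduces the identity to one coordinate at a time. *)
rewrite [K L x x](_ : _ = K L x x * \sum_i coord i x ^+ 2); last first.
  by rewrite sphere_coord_sqr_sum mulr1.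
rewrite !mulr_sumr -sumrB.
apply: eq_bigr => i _.
pose Z y := K L.+1 x y - K L x y.
have bZ : bounded_measurable Z by exact: bounded_measurableB.
have odd0 : \int[mu]_y (coord i y * Z y ^+ 2) = 0.
  apply: integral_antipode_odd; first by apply: bounded_measurableM => //; exact: bounded_measurableX.
  move=> y; rewrite coord_antipode /Z kernel_increment_antipode exprMn sqrr_sign mul1r.
  by rewrite mulNr.
have cross : \int[mu]_y (coord i y * K L x y * K L.+1 x y) = coord i x * K L x x.
  exact: (kernel_reproducing (hK L.+1) x (Pi_space_coordM i (kernel_Pi (hK L) x))).
have bKK L' : bounded_measurable (fun y => coord i y * K L' x y ^+ 2).
  by apply: bounded_measurableM => //; exact: bounded_measurableX.
have bZZ : bounded_measurable (fun y => coord i y * Z y ^+ 2).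
  by apply: bounded_measurableM => //; exact: bounded_measurableX.
have bX : bounded_measurable (fun y => coord i y * K L x y * K L.+1 x y).
  by do 2 (apply: bounded_measurableM => //).
have E : \int[mu]_y (coord i y * K L.+1 x y ^+ 2) =
    2 * (coord i x * K L x x) - \int[mu]_y (coord i y * K L x y ^+ 2).
  (* Squaring Z = K_{L+1} - K_L gives K_{L+1}^2 = 2 K_L K_{L+1} - K_L^2 + Z^2. *)
  transitivity (\int[mu]_y (2 * (coord i y * K L x y * K L.+1 x y) -
      coord i y * K L x y ^+ 2 + coord i y * Z y ^+ 2)).
    by apply: eq_Rintegral => y _; rewrite /Z; ring.
  have b2 : bounded_measurable (fun y => 2 * (coord i y * K L x y * K L.+1 x y)).
    by apply: bounded_measurableM => //; exact: bounded_measurable_cst.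
  rewrite bmRintegralD//; last exact: bounded_measurableB.
  by rewrite odd0 addr0 bmRintegralB// bmRintegralZl// cross.
by rewrite E; ring.
Qed.

Lemma bounded_measurable_weighted_kernel L : bounded_measurable (W L).
Proof.
apply: bounded_measurable_sum => i; apply: bounded_measurableM => //.
exact: bounded_measurable_kernel_sqr.
Qed.

Lemma integral_weighted_kernelS L :
  \int[mu]_x W L.+1 x = 2 * (pi_dim R d L)%:R - \int[mu]_x W L x.
Proof.
under eq_Rintegral do rewrite weighted_kernel_rec.
have bD := bounded_measurable_kernel_diag (hK L).
rewrite bmRintegralB; last 2 first.
- by apply: bounded_measurableM => //; exact: bounded_measurable_cst.
- exact: bounded_measurable_weighted_kernel.
by rewrite bmRintegralZl// (kernel_trace (hK L)).
Qed.

(** Initial value of the recursion: K_0(x, y) is constant in y, and each coordinate of y is odd. *)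
Lemma integral_weighted_kernel0 : \int[mu]_x W 0 x = 0.
Proof.
rewrite -[RHS](Rintegral_cst_probability mu 0); apply: eq_Rintegral => x _.
rewrite /W big1// => i _; have [c ->] := Pi_space0_cst (kernel_Pi (hK 0) x).
rewrite integral_antipode_odd ?mulr0//.
  by apply: bounded_measurableM => //; exact: bounded_measurable_cst.
by move=> y; rewrite coord_antipode mulNr.
Qed.

(** On the sphere |x - y|^2 = 2 - 2 x.y, and the factor one half cancels the 2; the constant part
    integrates to the trace of the kernel. *)
Lemma sum_variance_formE L :
  \sum_i variance_form mu (K L) (coord i) = (pi_dim R d L)%:R - \int[mu]_x W L x.
Proof.
rewrite /variance_form -mulr_sumr -bmRintegral_sum; last first.
  by move=> i; exact: bounded_measurable_inner_variance.
have bD := bounded_measurable_kernel_diag (hK L); have bW := bounded_measurable_weighted_kernel L.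
have E x : \sum_i \int[mu]_y ((coord i x - coord i y) ^+ 2 * K L x y ^+ 2) =
    2 * (K L x x - W L x).
  under eq_bigr do rewrite (inner_varianceE (hK L))//.
  rewrite big_split sumrB/= -mulr_suml sphere_coord_sqr_sum mul1r.
  under [X in _ - X]eq_bigr do rewrite -mulrA.
  rewrite -mulr_sumr -/(W L x) -bmRintegral_sum; last first.
    by move=> i; apply: bounded_measurableM; exact: bounded_measurableX.
  rewrite [X in _ + X](_ : _ = K L x x); first by ring.
  rewrite -[RHS](kernel_sqr (hK L)); apply: eq_Rintegral => y _.
  by rewrite -mulr_suml sphere_coord_sqr_sum mul1r.
under eq_Rintegral do rewrite E.
rewrite bmRintegralZl; last exact: bounded_measurableB.
by rewrite mulrA mulVf// mul1r bmRintegralB// (kernel_trace (hK L)).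
Qed.

Lemma variance_form_ge0 L f : 0 <= variance_form mu (K L) f.
Proof.
rewrite mulr_ge0//; apply: Rintegral_ge0 => x _; apply: Rintegral_ge0 => y _.
by rewrite mulr_ge0 ?sqr_ge0.
Qed.

Lemma variance_form_le L f (C : R) : bounded_measurable f ->
  (forall x y, (f x - f y) ^+ 2 <= C * \sum_i (coord i x - coord i y) ^+ 2) ->
  variance_form mu (K L) f <= C * \sum_i variance_form mu (K L) (coord i).
Proof.
move=> bf fC; rewrite /variance_form -mulr_sumr mulrCA ler_pM2l ?invr_gt0//.
have bc := bounded_measurable_cst; have biv := bounded_measurable_inner_variance (hK L).
rewrite -bmRintegral_sum; last by move=> i; exact: biv.
have bs : bounded_measurable (fun x => \sum_i
    \int[mu]_y ((coord i x - coord i y) ^+ 2 * K L x y ^+ 2)).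
  by apply: bounded_measurable_sum => i; exact: biv.
rewrite -bmRintegralZl//; apply: le_bmRintegral => [||x].
- exact: biv.
- exact: bounded_measurableM.
have bi (g : S -> R) : bounded_measurable g ->
    bounded_measurable (fun y => (g x - g y) ^+ 2 * K L x y ^+ 2).
  move=> bg; apply: bounded_measurableM; apply: bounded_measurableX => //.
  exact: bounded_measurableB.
rewrite -bmRintegral_sum; last by move=> i; exact: bi.
have bsum : bounded_measurable (fun y => \sum_i (coord i x - coord i y) ^+ 2 * K L x y ^+ 2).
  by apply: bounded_measurable_sum => i; exact: bi.
rewrite -bmRintegralZl//; apply: le_bmRintegral => [||y].
- exact: bi.
- exact: bounded_measurableM.
by rewrite -mulr_suml mulrA ler_wpM2r ?sqr_ge0.
Qed.

(** The transported kernel [K'] also reproduces [Pi L], because the action preserves both mu and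
    [Pi L]; uniqueness of the reproducing kernel gives the equality. *)
Lemma kernel_act L s b x y : K L (sphere_act s b x) (sphere_act s b y) = K L x y.
Proof.
pose s' := (s^-1)%g.
have actK (z : S) : sphere_act s' b (sphere_act s b z) = z.
  apply: sphere_eqP => i; rewrite !coord_sphere_act permKV mulrA -expr2.
  by rewrite sqrr_sign mul1r.
pose K' x y := K L (sphere_act s b x) (sphere_act s b y).
have PK' (z : S) : Pi L (K' z) by apply: Pi_space_act; exact: kernel_Pi (hK L) _.
have rK' f (z : S) : Pi L f -> \int[mu]_y (f y * K' z y) = f z.
  move=> pf; have pf' := Pi_space_act s' b pf.
  rewrite -[RHS](congr1 f (actK z)) -(kernel_reproducing (hK L) _ pf').
  rewrite -[RHS](integral_sphere_act s b emu).
    by apply: eq_Rintegral => w _; rewrite /= actK.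
  by apply: bounded_measurableM => //; exact: bounded_measurable_Pi pf'.
rewrite -/(K' x y) -(kernel_reproducing (hK L) y (PK' x)).
rewrite [RHS](kernel_sym (hK L)) -(rK' _ x (kernel_Pi (hK L) y)).
by apply: eq_Rintegral => z _; rewrite mulrC.
Qed.

Lemma variance_form_coord L i j :
  variance_form mu (K L) (coord i) = variance_form mu (K L) (coord j).
Proof.
rewrite /variance_form; congr (_ * _).
pose s := tperm i j; have biv := bounded_measurable_inner_variance (hK L) (bcoord i).
rewrite -(integral_sphere_act s false emu biv); apply: eq_Rintegral => x _.
pose x' := sphere_act s false x.
have bi : bounded_measurable (fun y => (coord i x' - coord i y) ^+ 2 * K L x' y ^+ 2).
  apply: bounded_measurableM; apply: bounded_measurableX => //.
  by apply: bounded_measurableB => //; exact: bounded_measurable_cst.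
rewrite -/x' -(integral_sphere_act s false emu bi); apply: eq_Rintegral => y _.
by rewrite kernel_act !coord_sphere_act tpermL expr0 !mul1r.
Qed.

End kernel_sequence.

Lemma sum_variance_form (R : realType) (d : nat)
  (mu : probability (sphere R d.+1) R) (K : nat -> sphere R d.+1 -> sphere R d.+1 -> R) :
  @surface_measure R d.+1 = mu :> (_ -> _) ->
  (forall L, reproducing_kernel mu (@Pi_space R d.+1 L) (K L)) -> forall L,
  \sum_i variance_form mu (K L) (@sphere_coord R d.+1 i) = 'C(d + L, d)%:R.
Proof.
move=> emu hK; elim=> [|L ih]; rewrite (sum_variance_formE hK).
  rewrite (integral_weighted_kernel0 emu hK) pi_dimE !addn0 binn.
  by rewrite bin_small// addn0 binn subr0.
rewrite (integral_weighted_kernelS emu hK).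
move: ih; rewrite (sum_variance_formE hK) !pi_dimE.
(* Pascal's rule turns a_{L+1} + a_L = pi_{L+1} - pi_L into a linear identity between binomial
   coefficients. *)
rewrite !addSn !binS addnS binS !natrD; lra.
Qed.

(** * Smooth functions are Lipschitz *)

Section C1_lipschitz.
Variables (R : realType) (n : nat).
Implicit Types (U : set 'rV[R]_n.+1) (F : 'rV[R]_n.+1 -> R) (p x y v : 'rV[R]_n.+1).

Lemma rV_coord_le_norm v i : `|v 0 i| <= `|v|.
Proof.
rewrite [leRHS]/Num.norm/= mx_normrE.
exact: (le_bigmax _ (fun ij : 'I_1 * 'I_n.+1 => `|v ij.1 ij.2|) (0, i)).
Qed.

Lemma is_derive_segment F x v (t : R) : derivable F (x + t *: v) v ->
  is_derive t (1 : R) (fun s : R => F (x + s *: v)) ('D_v F (x + t *: v)).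
Proof.
have E : (fun h : R => h^-1 *: (((fun s : R => F (x + s *: v)) \o shift t) (h *: (1 : R)) -
      F (x + t *: v))) =
    (fun h : R => h^-1 *: ((F \o shift (x + t *: v)) (h *: v) - F (x + t *: v))).
  apply/funext => h /=; congr (_ *: (F _ - _)).
  by rewrite [h *: 1]mulr1 scalerDl addrCA.
by move=> dF; split; rewrite /derivable /derive E.
Qed.

(** By continuity each partial derivative stays below its absolute value at p plus one on some ball.
    The mean value theorem along a segment of that ball gives the sum of these bounds as constant,
    since the norm is the maximum norm. *)
Lemma C1_locally_lipschitz U F p : open U -> U p -> C1_on U F ->
  exists M r : R, 0 < r /\ forall x y, `|p - x| < r -> `|p - y| < r ->
    `|F y - F x| <= M * `|y - x|.
Proof.
move=> oU Up C1.
pose m i := `|'D_('e_i) F p| + 1.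
have nU : \forall z \near p, U z by exact: open_nbhs_nbhs.
have nD : \forall z \near p, forall i : 'I_n.+1, `|'D_('e_i) F z| < m i.
  have nDi (i : 'I_n.+1) : nbhs p [set z | `|'D_('e_i) F z| < m i].
    have [_ /(_ 'e_i) cD] := C1 _ Up.
    by apply: (cvgr_norm_lt _ cD); rewrite ltrDl.
  exact: (filter_forall _ nDi).
have nUD : nbhs p (U `&` [set z | forall i, `|'D_('e_i) F z| < m i]) by exact: filterI.
have [r /= r0 rP] := (nbhs_ballP _ _).1 nUD.
exists (\sum_i m i), r; split => // x y px py.
pose v := y - x.
(* The segment stays in the ball by convexity. The case t = 0 is separate because strictness is
   drawn from the term in y. *)
have zP (t : R) : 0 <= t <= 1 -> (U `&` [set z | forall i, `|'D_('e_i) F z| < m i]) (x + t *: v).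
  move=> /andP[t0 t1]; apply: rP; rewrite -ball_normE /=.
  have -> : p - (x + t *: v) = (1 - t) *: (p - x) + t *: (p - y).
    by rewrite /v; apply/rowP => i; rewrite !mxE; ring.
  apply: le_lt_trans (ler_normD _ _) _; rewrite !normrZ ger0_norm ?subr_ge0// ger0_norm//.
  have [->|tN0] := eqVneq t 0; first by rewrite subr0 mul1r mul0r addr0.
  have tp : 0 < t by rewrite lt_def tN0.
  have : t * `|p - y| < t * r by rewrite ltr_pM2l.
  have : (1 - t) * `|p - x| <= (1 - t) * r by rewrite ler_wpM2l ?subr_ge0// ltW.
  lra.
have dF (t : R) : 0 <= t <= 1 -> is_derive t (1 : R) (fun s : R => F (x + s *: v)) ('D_v F (x + t *: v)).
  by move=> /zP[Uz _]; apply/is_derive_segment/diff_derivable; case: (C1 _ Uz).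
have [||c] := @MVT_segment R (fun s : R => F (x + s *: v)) (fun t => 'D_v F (x + t *: v)) 0 1 ler01.
- by move=> t; rewrite in_itv/= => /andP[t0 t1]; apply: dF; rewrite !ltW.
- by apply: derivable_within_continuous => t; rewrite in_itv/= => t01; case: (dF t t01).
rewrite in_itv/= => c01; rewrite scale0r addr0 scale1r subr0 mulr1.
have vE : x + v = y by rewrite /v addrC subrK.
rewrite vE => ->.
have [Uz Dz] := zP c c01; have [dFz _] := C1 _ Uz.
rewrite deriveE// [in X in 'd F _ X](row_sum_delta v) linear_sum/=.
apply: le_trans (ler_norm_sum _ _ _) _; rewrite mulr_suml; apply: ler_sum => i _.
rewrite linearZ/= normrM mulrC -deriveE//.
by apply: ler_pM => //; [exact: ltW|exact: rV_coord_le_norm].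
Qed.

End C1_lipschitz.

Section sphere_lipschitz.
Variables (R : realType) (d : nat).
Local Notation S := (sphere R d).
Local Notation coord := (@sphere_coord R d).

Definition sphere_lipschitz (f : S -> R) (C : R) :=
  forall x y, `|f x - f y| <= C * `|sval x - sval y|.

Lemma continuous_sum_sqr (s : seq 'I_d.+1) :
  continuous (fun v : 'rV[R]_d.+1 => \sum_(i <- s) v 0 i ^+ 2).
Proof.
elim: s => [|i s ih].
  rewrite (_ : (fun v => _) = fun=> 0); first exact: cst_continuous.
  by apply: funext => w; rewrite big_nil.
rewrite (_ : (fun v => _) = (fun v : 'rV[R]_d.+1 => v 0 i ^+ 2) \+
    (fun v => \sum_(i <- s) v 0 i ^+ 2)); last by apply: funext => w; rewrite big_cons.
move=> w; apply: continuousD; last exact: ih.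
apply: (@continuous_comp _ _ _ (fun v : 'rV[R]_d.+1 => v 0 i) (fun x : R => x ^+ 2)).
  exact: coord_continuous.
exact: exprn_continuous.
Qed.

Lemma sphere_compact : compact [set v : 'rV[R]_d.+1 | \sum_i v 0 i ^+ 2 = 1].
Proof.
apply: bounded_closed_compact.
  exists 1; split; first exact: num_real.
  move=> r r1 v /= v1; apply: ltW; apply: le_lt_trans r1.
  rewrite /Num.norm/= mx_normrE; apply: bigmax_le => // -[i j] _ /=.
  rewrite (ord1 i) -(@expr_le1 _ 2)// real_normK ?num_real// -v1.
  by rewrite (bigD1 j)//= lerDl sumr_ge0// => k _; rewrite sqr_ge0.
rewrite (_ : [set _ | _] = (fun v : 'rV[R]_d.+1 => \sum_i v 0 i ^+ 2) @^-1` [set 1])//.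
apply: preimage_closed => [v _|]; last exact: closed_eq.
exact: continuous_sum_sqr.
Qed.

Lemma C1_sphere_locally_lipschitz (f : S -> R) (p : S) : C1_sphere f ->
  exists M r : R, 0 < r /\ forall x y : S, `|sval p - sval x| < r -> `|sval p - sval y| < r ->
    `|f x - f y| <= M * `|sval x - sval y|.
Proof.
move=> /(_ p) [U [F [oU Up C1 fE]]].
have [M [r [r0 MP]]] := C1_locally_lipschitz oU Up C1.
have [e /= e0 eU] := (nbhs_ballP _ _).1 (open_nbhs_nbhs (conj oU Up)).
exists M, (Num.min r e); split; first by rewrite lt_min r0.
move=> x y; rewrite !lt_min => /andP[xr xe] /andP[yr ye].
rewrite !fE; [exact: MP|apply: eU; rewrite -ball_normE//..].
Qed.

(** Compactness is applied to pairs of points. Near a diagonal pair the local Lipschitz bound holds;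
    near any other pair f is bounded and the distance is bounded below. Letting the constant tend to
    +oo along a filter absorbs the finitely many local constants at once. *)
Lemma C1_sphere_lipschitz (f : S -> R) : C1_sphere f -> exists C, sphere_lipschitz f C.
Proof.
move=> C1; pose K := [set v : 'rV[R]_d.+1 | \sum_i v 0 i ^+ 2 = 1].
(* Compactness lives in the ambient space, so pairs are ambient vectors and points of the sphere
   enter through their underlying vectors. *)
pose P (C : R) (uv : 'rV[R]_d.+1 * 'rV[R]_d.+1) := forall x y : S,
  sval x = uv.1 -> sval y = uv.2 -> `|f x - f y| <= C * `|uv.1 - uv.2|.
have /compact_near_coveringP/(_ R (pinfty_nbhs R) P) := compact_setX sphere_compact sphere_compact.
have toS u : K u -> exists p : S, sval p = u by move=> /eqP Ku; exists (exist _ u Ku).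
move=> /(_ _ _)[].
  move=> [u v] [/= /toS[p <-] /toS[q <-]] {u v}.
  have [M1 [r1 [r10 H1]]] := C1_sphere_locally_lipschitz p C1.
  have [M2 [r2 [r20 H2]]] := C1_sphere_locally_lipschitz q C1.
  have [pq|pq] := eqVneq (sval p) (sval q).
    exists (ball (sval p) r1 `*` ball (sval q) r1, [set C | M1 <= C]).
      split; last by exists M1; split; [exact: num_real|move=> C /ltW].
      by exists (ball (sval p) r1, ball (sval q) r1) => //; split; exact: nbhsx_ballx.
    move=> [[u v] C] /= [[]]; rewrite -ball_normE -pq/= => pu pv MC x y /= xu yv; subst u v.
    by apply: le_trans (H1 x y pu pv) _; rewrite ler_wpM2r.
  pose delta := `|sval p - sval q|.
  have delta0 : 0 < delta by rewrite normr_gt0 subr_eq0.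
  pose N1 := `|M1| * r1; pose N2 := `|M2| * r2; pose N := N1 + N2 + `|f p - f q|.
  have N0 : 0 <= N by rewrite !addr_ge0// mulr_ge0// ltW.
  (* Moving p and q by less than delta / 4 each leaves a distance of at least delta / 2, while [N]
     bounds |f x - f y|; hence the constant N / (delta / 2). *)
  pose e1 := Num.min r1 (delta / 4); pose e2 := Num.min r2 (delta / 4).
  have d40 : 0 < delta / 4 by rewrite divr_gt0.
  exists (ball (sval p) e1 `*` ball (sval q) e2, [set C | N * 2 / delta <= C]).
    split; last by exists (N * 2 / delta); split; [exact: num_real|move=> C /ltW].
    exists (ball (sval p) e1, ball (sval q) e2) => //.
    by split; apply: nbhsx_ballx; rewrite lt_min ?r10 ?r20.
  move=> [[u v] C] /= [[]]; rewrite -ball_normE/= !lt_min => /andP[pu pu'] /andP[qv qv'] MC x y /= xu yv; subst u v.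
  have fxp : `|f p - f x| <= N1.
    apply: le_trans (H1 p x _ pu) _; first by rewrite subrr normr0.
    apply: (@le_trans _ _ (`|M1| * `|sval p - sval x|)).
      by rewrite ler_wpM2r// ler_norm.
    by rewrite /N1 ler_wpM2l// ltW.
  have fyq : `|f q - f y| <= N2.
    apply: le_trans (H2 q y _ qv) _; first by rewrite subrr normr0.
    apply: (@le_trans _ _ (`|M2| * `|sval q - sval y|)).
      by rewrite ler_wpM2r// ler_norm.
    by rewrite /N2 ler_wpM2l// ltW.
  have fxy : `|f x - f y| <= N.
    have -> : f x - f y = - (f p - f x) + (f q - f y) + (f p - f q) by ring.
    apply: le_trans (ler_normD _ _) _; rewrite lerD2r.
    by apply: le_trans (ler_normD _ _) _; rewrite normrN lerD.
  have xy : delta / 2 <= `|sval x - sval y|.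
    have : delta <= `|sval p - sval x| + `|sval x - sval y| + `|sval q - sval y|.
      rewrite /delta [`|sval q - sval y|]distrC.
      have -> : sval p - sval q = (sval p - sval x) + (sval x - sval y) + (sval y - sval q).
        by apply/rowP => i; rewrite !mxE; ring.
      apply: le_trans (ler_normD _ _) _; rewrite lerD2r; exact: ler_normD.
    lra.
  apply: le_trans fxy _; apply: (@le_trans _ _ (N * 2 / delta * (delta / 2))).
    have -> : N * 2 / delta * (delta / 2) = N by field; rewrite gt_eqF.
    by [].
  apply: ler_pM; [by rewrite divr_ge0 ?mulr_ge0 ?(ltW delta0)|
    by rewrite divr_ge0 ?(ltW delta0)|exact: MC|exact: xy].
(* A neighbourhood of +oo only contains the constants strictly above some [C]. *)
move=> C [_ CP]; exists (C + 1) => x y; have C1' : C < C + 1 by rewrite ltrDl.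
by apply: (CP _ C1' (sval x, sval y)) => //; split; apply/eqP; exact: (svalP (_ : S)).
Qed.

End sphere_lipschitz.

Section sphere_lipschitz_theory.
Variables (R : realType) (d : nat).
Local Notation S := (sphere R d).
Local Notation coord := (@sphere_coord R d).

Lemma sphere_dist_le (x y : S) (e : R) : 0 <= e ->
  (forall i, `|coord i x - coord i y| <= e) -> `|sval x - sval y| <= e.
Proof.
move=> e0 xy; rewrite [leLHS]/Num.norm/= mx_normrE; apply: bigmax_le => // -[i j] _ /=.
by rewrite (ord1 i) !mxE; exact: xy.
Qed.

(** The norm on row vectors is the maximum norm, which the Euclidean norm dominates; the Euclidean
    form is the one comparable with the coordinate variances. *)
Lemma sphere_dist_sqr_le (x y : S) :
  `|sval x - sval y| ^+ 2 <= \sum_i (coord i x - coord i y) ^+ 2.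
Proof.
set s := \sum_i _; have s0 : 0 <= s by apply: sumr_ge0 => i _; exact: sqr_ge0.
rewrite -[leRHS]sqr_sqrtr// lerXn2r ?nnegrE ?sqrtr_ge0//.
apply: sphere_dist_le; first exact: sqrtr_ge0.
move=> i; rewrite -sqrtr_sqr ler_wsqrtr// /s (bigD1 i)//= lerDl.
by apply: sumr_ge0 => j _; exact: sqr_ge0.
Qed.

Lemma sphere_lipschitz_sqr (f : S -> R) C : sphere_lipschitz f C ->
  forall x y, (f x - f y) ^+ 2 <= C ^+ 2 * \sum_i (coord i x - coord i y) ^+ 2.
Proof.
move=> fC x y; apply: (@le_trans _ _ (C ^+ 2 * `|sval x - sval y| ^+ 2)).
  rewrite -exprMn -real_normK ?num_real//; apply: lerXn2r; last exact: fC.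
    by rewrite nnegrE.
  by rewrite nnegrE; apply: le_trans (fC x y).
by rewrite ler_wpM2l ?sqr_ge0// sphere_dist_sqr_le.
Qed.

(* f is the pointwise limit of functions that are constant on the cells of
   finer and finer cubical grids. *)
Lemma sphere_lipschitz_measurable (f : S -> R) C : sphere_lipschitz f C ->
  measurable_fun setT f.
Proof.
move=> fC.
pose cell n (x : S) : {ffun 'I_d.+1 -> int} := [ffun i => Num.floor (n.+1%:R * coord i x)].
(* A representative of each cell; the default [point] is taken only for empty cells, which no x
   reaches. *)
pose q n k : S := xget point [set x | cell n x = k].
have mcell n k : measurable [set x | cell n x = k].
  rewrite (_ : [set _ | _] = \bigcap_(i in [set: 'I_d.+1])
      (fun x => n.+1%:R * coord i x) @^-1` `[(k i)%:~R, (k i + 1)%:~R[%classic).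
    apply: fin_bigcap_measurable => // i _.
    rewrite -[X in measurable X]setTI.
    have mf : measurable_fun setT (fun x => n.+1%:R * coord i x).
      by apply: measurable_funM => //; exact: measurable_sphere_coord.
    exact: mf.
  apply/seteqP; split => [x /= <- i _|x H]; rewrite /= ?in_itv/=.
    by rewrite ffunE floor_le floorD1_gt.
  apply/ffunP => i; rewrite ffunE; apply: floor_def.
  by have := H i Logic.I; rewrite /= in_itv.
have mh n : measurable_fun setT (fun x => f (q n (cell n x))).
  move=> _ B mB; rewrite setTI.
  rewrite (_ : _ @^-1` _ = \bigcup_k (if `[< B (f (q n k)) >] then [set x | cell n x = k] else set0)).
    by apply: countable_bigcupT_measurable => // k; case: ifP.
  apply/seteqP; split => [x /= Bx|x [k _]]; last first.
    by case: asboolP => //= Bk xk; rewrite xk.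
  by exists (cell n x) => //; rewrite asboolT.
apply: (measurable_fun_cvg mh) => x _.
(* Two points of the same cell have equal floors, so their coordinates differ by at most the mesh
   1/(n + 1). *)
have dist n : `|f x - f (q n (cell n x))| <= `|C| * n.+1%:R^-1.
  apply: le_trans (fC _ _) _; apply: le_trans (ler_wpM2r _ (ler_norm C)) _ => //.
  rewrite ler_wpM2l//; apply: sphere_dist_le => // i.
  have cq : cell n (q n (cell n x)) = cell n x.
    exact: (@xgetPex _ point [set x' | cell n x' = cell n x] (ex_intro _ x erefl)).
  have := congr1 (fun k : {ffun 'I_d.+1 -> int} => k i) cq; rewrite !ffunE => fl.
  have n0 : 0 < n.+1%:R :> R by rewrite ltr0n.
  rewrite -(ler_pM2l n0) mulfV ?gt_eqF// -[X in X * _](gtr0_norm n0) -normrM mulrBr.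
  set u := n.+1%:R * coord i x in fl *; set v := n.+1%:R * coord i _ in fl *.
  have := floorD1_gt u; have := floorD1_gt v; rewrite fl.
  have := floor_le u; have := floor_le v; rewrite fl.
  rewrite intrD => ? ? ? ?; rewrite ler_norml; apply/andP; split; lra.
apply/cvgrPdist_le => e e0.
have : `|C| * n.+1%:R^-1 @[n --> \oo] --> (`|C| * 0 : R).
  by apply: cvgM; [exact: cvg_cst|exact: cvg_harmonic].
rewrite mulr0 => /cvgrPdist_le/(_ e e0); apply: filterS => n /=.
rewrite sub0r normrN ger0_norm ?mulr_ge0// => H.
exact: le_trans (dist n) H.
Qed.

Lemma sphere_lipschitz_bounded_measurable (f : S -> R) C : sphere_lipschitz f C ->
  bounded_measurable f.
Proof.
move=> fC; split; first exact: sphere_lipschitz_measurable fC.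
exists (`|f point| + `|C| * 2) => x.
rewrite -[f x](subrK (f point)) addrC; apply: le_trans (ler_normD _ _) _.
rewrite lerD2l; apply: le_trans (fC _ _) _.
apply: le_trans (ler_wpM2r _ (ler_norm C)) _ => //; rewrite ler_wpM2l//.
apply: sphere_dist_le => // i; apply: le_trans (ler_normB _ _) _.
by rewrite [leRHS](_ : 2 = 1 + 1)// lerD// sphere_coord_le1.
Qed.

End sphere_lipschitz_theory.

(** * Variance of linear statistics *)

Section harmonic_variance.
Variables (R : realType) (d L : nat) (disp : measure_display).
Variables (Omega : measurableType disp) (P : probability Omega R).
Variable X : {mfun Omega >-> (pi_dim R d L).-tuple (sphere R d)}.
Variables (mu : probability (sphere R d) R) (K : sphere R d -> sphere R d -> R).
Hypothesis hK : reproducing_kernel mu (@Pi_space R d L) K.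
Local Notation n := (pi_dim R d L).
Hypothesis XE : forall A, measurable A ->
  distribution P X A = (\int[product_power mu n]_(t in A)
    (n`!%:R^-1 * \det (\matrix_(i, j) K (tnth t i) (tnth t j)))%:E)%E.

Let mean (f : sphere R d -> R) := \int[P]_w (\sum_j f (tnth (X w) j)).

Lemma Rintegral_distribution (g : n.-tuple (sphere R d) -> R) : bounded_measurable g ->
  \int[distribution P X]_t g t = \int[P]_w g (X w).
Proof.
move=> bg; congr fine; apply: (@integral_distribution _ _ _ _ _ P X (EFin \o g)).
  by apply/measurable_EFinP; case: bg.
apply: (@bounded_measurable_integrable _ _ _ P (g \o X)).
by have [mg [C gC]] := bg; split; [exact: measurableT_comp|exists C => w; exact: gC].
Qed.

Lemma bounded_measurable_linear_statistic (f : sphere R d -> R) : bounded_measurable f ->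
  bounded_measurable (fun t : n.-tuple (sphere R d) => \sum_j f (tnth t j)).
Proof. by move=> bf; apply: bounded_measurable_sum => a; exact: bounded_measurable_tnth. Qed.

Lemma real_variance f : bounded_measurable f ->
  \int[P]_w (\sum_j f (tnth (X w) j) - mean f) ^+ 2 = variance_form mu K f.
Proof.
move=> bf; have [e be] := Pi_space_basis R d L.
have [c [Vc ec KE]] := kernel_biorthogonal hK be.
have [M eM prodM] := product_power_probability mu n.
have bS := bounded_measurable_linear_statistic bf.
have nuE A : measurable A -> distribution P X A = (\int[M]_(t in A)
    (n`!%:R^-1 * \det (\matrix_(i, j) (\sum_k e k (tnth t i) * c k (tnth t j))))%:E)%E.
  move=> mA; rewrite XE// eM; apply: eq_integral => t _; congr (_ * \det _)%:E.
  by apply/matrixP => i j; rewrite !mxE KE.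
have EV := ensemble_variance (fun k => bounded_measurable_Pi (be.1 k))
  (fun k => bounded_measurable_Pi (Vc k)) ec prodM (nu := distribution P X) nuE bf.
pose g (t : n.-tuple (sphere R d)) := (\sum_a f (tnth t a) - mean f) ^+ 2.
have bg : bounded_measurable g.
  apply: bounded_measurableX; apply: bounded_measurableB => //.
  exact: bounded_measurable_cst.
rewrite -[LHS](Rintegral_distribution bg) /g /mean -(Rintegral_distribution bS).
rewrite [LHS]EV /variance_form; congr (_ * _).
apply: eq_Rintegral => x _; apply: eq_Rintegral => y _.
by rewrite -!KE (kernel_sym hK y x) expr2.
Qed.

Lemma linear_statistic_variance (phi : sphere R d -> complex R) :
  bounded_measurable (fun x => complex.Re (phi x)) ->
  bounded_measurable (fun x => complex.Im (phi x)) ->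
  complex_variance P (linear_statistic phi X) =
  (variance_form mu K (fun x => complex.Re (phi x)) +
   variance_form mu K (fun x => complex.Im (phi x)))%:E.
Proof.
move=> bre bim.
have ReE w : complex.Re (linear_statistic phi X w) =
    \sum_j complex.Re (phi (tnth (X w) j)) by rewrite /linear_statistic raddf_sum.
have ImE w : complex.Im (linear_statistic phi X w) =
    \sum_j complex.Im (phi (tnth (X w) j)) by rewrite /linear_statistic raddf_sum.
have meanE : complex_expectation P (linear_statistic phi X) =
    Complex (mean (fun x => complex.Re (phi x))) (mean (fun x => complex.Im (phi x))).
  rewrite /complex_expectation unlock; congr (Complex (fine _) (fine _));
    by apply: eq_integral => w _; rewrite ?ReE ?ImE.
rewrite /complex_variance meanE unlock.
have bX g : bounded_measurable g ->
    bounded_measurable (fun w => (\sum_j g (tnth (X w) j) - mean g) ^+ 2).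
  move=> bg; apply: bounded_measurableX; apply: bounded_measurableB; last first.
    exact: bounded_measurable_cst.
  have [mg [C gC]] := bounded_measurable_linear_statistic bg.
  by split; [exact: (measurableT_comp mg)|exists C => w; exact: gC].
rewrite -!real_variance// -bmRintegralD ?bmRintegralE//; last 3 first.
- by apply: bounded_measurableD; exact: bX.
- exact: bX.
- exact: bX.
apply: eq_integral => w _; rewrite -ReE -ImE; case: (linear_statistic phi X w) => a b /=.
by rewrite /ComplexField.Normc.normc/= sqr_sqrtr// addr_ge0// sqr_ge0.
Qed.

End harmonic_variance.

(** * Growth of binomial coefficients and the asymptotic statement *)

Lemma binomial_le k L : ('C(k + L, k) <= L.+1 ^ k)%N.
Proof.
elim: k => [|k ih]; first by rewrite bin0.
(* Uses (k+1) C(k+1+L, k+1) = (k+1+L) C(k+L, k) and k+1+L <= (k+1)(L+1). *)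
rewrite -(leq_pmul2l (ltn0Sn k)) addSn -mul_bin_diag expnS mulnA.
by apply: leq_mul => //; rewrite mulSn mulnS addnA !addSn ltnS [(k + L)%N]addnC leq_addr.
Qed.

Lemma binomial_ge k L : (L ^ k <= 'C(k + L, k) * k`!)%N.
Proof.
elim: k => [|k ih]; first by rewrite bin0.
rewrite factS mulnA [('C(_, _) * k.+1)%N]mulnC addSn -mul_bin_diag -mulnA expnS.
by apply: leq_mul => //; exact: leqW (leq_addl _ _).
Qed.

(** A limsup is an infimum of suprema over neighbourhoods of infinity, and the positive integers are
    one. Index 0 has to be left out: there the power of L may vanish and the quotient be
    infinite. *)
Lemma asymp_leP (R : realType) (x y : (\bar R)^nat) (C : R) :
  (forall L, (0 < L)%N -> (x L / y L <= C%:E)%E) -> asymp_le x y.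
Proof.
move=> H; exists C; apply: (@le_trans _ _ (ereal_sup ((fun L => x L / y L)%E @` [set L | (0 < L)%N]))).
  by apply: ereal_inf_lbound; exists [set L | (0 < L)%N] => //; exists 1%N.
by apply: ge_ereal_sup => _ [L L0 <-]; exact: H.
Qed.

Theorem proposition3 (R : realType) (d : nat) (hd : (1 <= d)%N)
    (disp : nat -> measure_display)
    (Omega : forall L : nat, measurableType (disp L))
    (P : forall L : nat, probability (Omega L) R)
    (X : forall L : nat,
       {mfun Omega L >-> (pi_dim R d L).-tuple (sphere R d)})
    (HX : forall L : nat, harmonic_ensemble (P L) (X L)) :
  (forall phi : sphere R d -> complex R, complex_C1_sphere phi ->
     asymp_le
       (fun L => complex_variance (P L) (linear_statistic phi (X L)))
       (fun L => (L%:R ^+ d.-1)%:E))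
  /\
  (forall i : 'I_d.+1,
     asymp_sim
       (fun L => complex_variance (P L)
          (linear_statistic (fun x => real_complex R (sphere_coord i x)) (X L)))
       (fun L => (L%:R ^+ d.-1)%:E)).
Proof.
(* From here [d] is one less than the dimension of the sphere, so the rate is L^d and there are d +
   2 coordinates. *)
case: d hd X HX => // d _ X HX.
have [mu emu] := surface_measure_probability R d.+1.
have /choice[K KP] : forall L, exists K, reproducing_kernel mu (@Pi_space R d.+1 L) K /\
    forall A, measurable A -> distribution (P L) (X L) A =
      (\int[product_power mu (pi_dim R d.+1 L)]_(t in A)
        ((pi_dim R d.+1 L)`!%:R^-1 * \det (\matrix_(i, j) K (tnth t i) (tnth t j)))%:E)%E.
  by move=> L; case: (HX L) => K; rewrite emu; exists K.
have hK L := (KP L).1.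
pose V L := variance_form mu (K L).
have sumV L : \sum_i V L (@sphere_coord R d.+1 i) = 'C(d + L, d)%:R.
  exact: sum_variance_form.
have varE phi L : bounded_measurable (fun x => complex.Re (phi x)) ->
    bounded_measurable (fun x => complex.Im (phi x)) ->
    complex_variance (P L) (linear_statistic phi (X L)) =
    (V L (fun x => complex.Re (phi x)) + V L (fun x => complex.Im (phi x)))%:E.
  by move=> br bi; rewrite (linear_statistic_variance (hK L) (KP L).2).
have Ld L : (0 < L)%N -> 0 < L%:R ^+ d :> R by move=> L0; rewrite exprn_gt0// ltr0n.
(* The bound (L + 1)^d becomes (2 L)^d, as L is positive. *)
have upper L : (0 < L)%N -> 'C(d + L, d)%:R <= 2 ^+ d * L%:R ^+ d :> R.
  move=> L0; apply: (@le_trans _ _ (L.+1%:R ^+ d)); first by rewrite -natrX ler_nat binomial_le.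
  rewrite -exprMn lerXn2r ?nnegrE ?mulr_ge0//.
  by rewrite -natrM ler_nat mul2n -addnn -addn1 leq_add2l.
have lower L : L%:R ^+ d <= 'C(d + L, d)%:R * d`!%:R :> R.
  by rewrite -natrX -natrM ler_nat binomial_ge.
have coordV i L : V L (@sphere_coord R d.+1 i) = 'C(d + L, d)%:R / d.+2%:R.
  rewrite -sumV (eq_bigr (fun=> V L (@sphere_coord R d.+1 i))); last first.
    by move=> j _; exact: variance_form_coord.
  by rewrite sumr_const card_ord -[_ *+ _]mulr_natr mulfK// pnatr_eq0.
have varcoordE i L : complex_variance (P L)
    (linear_statistic (fun x => real_complex R (sphere_coord i x)) (X L)) =
    ('C(d + L, d)%:R / d.+2%:R)%:E.
  rewrite varE/=; [|exact: bounded_measurable_coord|exact: bounded_measurable_cst].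
  (* The imaginary part is the zero function, whose variance form is squeezed to 0 by the Lipschitz
     comparison with constant 0. *)
  rewrite coordV [X in _ + X](_ : _ = 0) ?addr0//; apply/eqP; rewrite eq_le.
  rewrite variance_form_ge0 andbT -(mul0r (\sum_i V L (@sphere_coord R d.+1 i))).
  apply: variance_form_le => // [|x y]; first exact: bounded_measurable_cst.
  by rewrite subrr expr0n mul0r.
split=> [phi [C1re C1im]|i].
  have [C lipre] := C1_sphere_lipschitz C1re; have [C' lipim] := C1_sphere_lipschitz C1im.
  have bre := sphere_lipschitz_bounded_measurable lipre.
  have bim := sphere_lipschitz_bounded_measurable lipim.
  apply: (@asymp_leP _ _ _ ((C ^+ 2 + C' ^+ 2) * 2 ^+ d)) => L L0.
  rewrite varE// inver gt_eqF ?Ld// -EFinM lee_fin ler_pdivrMr ?Ld// -mulrA.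
  apply: (@le_trans _ _ ((C ^+ 2 + C' ^+ 2) * 'C(d + L, d)%:R)).
    rewrite -sumV mulrDl lerD// variance_form_le//; exact: sphere_lipschitz_sqr.
  by rewrite ler_wpM2l ?upper// addr_ge0// sqr_ge0.
split.
  apply: (@asymp_leP _ _ _ (2 ^+ d)) => L L0; rewrite varcoordE.
  rewrite inver gt_eqF ?Ld// -EFinM lee_fin ler_pdivrMr ?Ld//.
  apply: le_trans (upper _ L0); rewrite ler_pdivrMr ?ltr0n// ler_peMr ?ler0n//.
  by rewrite ler1n.
(* The factor d! comes from C(d+L, d) d! >= L^d, the factor d + 2 from the equal share of each
   coordinate. *)
apply: (@asymp_leP _ _ _ (d`!%:R * d.+2%:R)) => L L0; rewrite varcoordE.
have c0 : 0 < 'C(d + L, d)%:R / d.+2%:R :> R.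
  by rewrite divr_gt0 ?ltr0n// bin_gt0 leq_addr.
rewrite inver gt_eqF// -EFinM lee_fin ler_pdivrMr// mulrACA mulfV ?pnatr_eq0// mulr1.
by rewrite mulrC lower.
Qed.
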